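(* For $i\in\{1,2\}$ let $G_i$ be a finite graph on $n_i$ vertices with no universal vertex, and let $k_i$ be a natural number with $k_i\le n_i-2$. If $\mathcal{B}_{\geq k_1}(G_1)\cong\mathcal{B}_{\geq k_2}(G_2)$, then $G_1\cong G_2$. (That is, a graph $G$ with no universal vertices is uniquely determined by $\mathcal{B}_{\geq k}(G)$ whenever $k\le |V(G)|-2$.)
   Context: All graphs are finite and simple. A vertex of $G$ is universal if it has degree $|V(G)|-1$. An independent set partition of $G$ is a partition of $V(G)$ into nonempty independent sets (parts). For such a partition $P$ and $v\in V(G)$, let $P-v$ be the partition of $V(G)\setminus\{v\}$ obtained by deleting $v$ from its part (discarding that part if it becomes empty). The Bell colouring graph $\mathcal{B}(G)$ has as vertices the independent set partitions of $G$, with $P\neq Q$ adjacent iff $P-v=Q-v$ for some $v\in V(G)$. For a natural number $k$, the upper-Bell $k$-colouring graph $\mathcal{B}_{\geq k}(G)$ is the induced subgraph of $\mathcal{B}(G)$ on the partitions with at least $k$ parts. *)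

(* Defs.v *)
From mathcomp Require Import all_boot.

Set Implicit Arguments.
Unset Strict Implicit.
Unset Printing Implicit Defensive.

Record sgraph := SGraph {
  vertex :> finType;
  adj : rel vertex;
  adj_sym : symmetric adj;
  adj_irrefl : irreflexive adj }.

Definition degree (G : sgraph) (v : G) : nat := #|[set w | adj v w]|.

(* The truncated predecessor is harmless: a graph with a vertex has order at
   least 1. *)
Definition universal (G : sgraph) (v : G) : bool := degree v == #|G|.-1.

Definition isomorphic (G H : sgraph) : Prop :=
  exists2 f : G -> H, bijective f & {mono f : x y / adj x y}.

Definition independent (G : sgraph) (A : {set G}) : bool :=
  [forall x in A, forall y in A, ~~ adj x y].

Definition indep_partition (G : sgraph) (P : {set {set G}}) : bool :=
  partition P [set: G] && [forall A in P, independent A].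

(* P - v: when P is a partition, set0 can only arise here from the part {v}. *)
Definition delete (T : finType) (P : {set {set T}}) (v : T) : {set {set T}} :=
  [set A :\ v | A in P] :\ set0.

Definition induced_adj (G : sgraph) (A : {set G}) : rel {x : G | x \in A} :=
  fun x y => adj (val x) (val y).

Lemma induced_sym (G : sgraph) (A : {set G}) : symmetric (@induced_adj G A).
Proof. by move=> x y; apply: adj_sym. Qed.

Lemma induced_irrefl (G : sgraph) (A : {set G}) :
  irreflexive (@induced_adj G A).
Proof. by move=> x; apply: adj_irrefl. Qed.

Definition induced (G : sgraph) (A : {set G}) : sgraph :=
  SGraph (@induced_sym G A) (@induced_irrefl G A).

Definition bell_vertex (G : sgraph) : finType :=
  {P : {set {set G}} | indep_partition P}.

Definition bell_adj (G : sgraph) : rel (bell_vertex G) :=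
  fun P Q => (P != Q) && [exists v, delete (val P) v == delete (val Q) v].

Lemma bell_sym (G : sgraph) : symmetric (@bell_adj G).
Proof.
move=> P Q; rewrite /bell_adj eq_sym; congr andb.
by apply: eq_existsb => v; rewrite eq_sym.
Qed.

Lemma bell_irrefl (G : sgraph) : irreflexive (@bell_adj G).
Proof. by move=> P; rewrite /bell_adj eqxx. Qed.

Definition bell (G : sgraph) : sgraph := SGraph (@bell_sym G) (@bell_irrefl G).

Definition upper_bell (k : nat) (G : sgraph) : sgraph :=
  induced [set P : bell G | k <= #|val P|].

(* Main.v *)
Require Import Defs.
From mathcomp Require Import all_boot.

Set Implicit Arguments.
Unset Strict Implicit.
Unset Printing Implicit Defensive.

(* Work with the complement graph, whose edges are the pairs that may share a part. For k <= n - 2, the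
   neighbours of the all-singletons partition T in B_{>=k}(G) are the complement edges, adjacent when
   they share an end, and a vertex at distance two from T that has two neighbours there is either a
   union of two disjoint edges or a triangle. So the ball of radius two around T is the line graph of
   the complement, together with the knowledge of which triples of pairwise meeting edges are
   triangles. This determines the complement, which has no isolated vertex.

   An isomorphism phi need not send T1 to T2. However, the local properties of T1 (rootlike) pass to
   P = phi(T1) and force every move from P to be of one of three kinds, each of which can be charged
   to its own complement edge of G2. This injects the edges of the complement of G1 into those of the
   complement of G2, and moves that are adjacent are charged to edges that meet. Since the same holds
   for the inverse of phi, both injections are bijections and preserve meeting in both directions;
   knowing that every edge is charged, one sees that triangles are preserved as well. *)

(** * Partitions as equivalence relations *)

(** The bound on [k] is the price of the vertices at distance two: two disjoint edges, or a
    triangle, merged out of singletons leave [n - 2] parts. The image of the root can really fail to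
    be discrete. When [k] imposes nothing, the Bell graph is the product of those of the components
    of the complement. On a star component all partitions are pairwise adjacent, and on a triangle
    component the partition into singletons can be exchanged with the one that has a single part.
    These examples are the source of the three kinds of moves: splitting a pair and moving the
    centre of a star, and extracting a vertex from a triangle. Around such an image one can safely
    build only refinements of known partitions, because it may have exactly [k] parts. Meeting alone
    does not suffice, since three edges of a triangle and three edges at a vertex have the same line
    graph. *)

Section Togetherness.
Variables (G : sgraph) (k : nat).
Implicit Types (x y : upper_bell k G) (s t u v : G).

Definition block x s := pblock (val (val x)) s.
Definition tog x s t := block x s == block x t.

Lemma block_partition x : partition (val (val x)) [set: G].
Proof. by case: (andP (valP (val x))). Qed.

Lemma tog_refl x s : tog x s s. Proof. exact: eqxx. Qed.

Lemma tog_sym x s t : tog x s t = tog x t s. Proof. exact: eq_sym. Qed.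

Lemma tog_trans x s t u : tog x s t -> tog x t u -> tog x s u.
Proof. by rewrite /tog => /eqP->. Qed.

Lemma tog_block x s t : tog x s t = (t \in block x s).
Proof.
have /and3P[/eqP cov triv _] := block_partition x.
by rewrite /tog eq_pblock ?cov.
Qed.

Lemma tog_indep x s t : tog x s t -> ~~ adj s t.
Proof.
have /and3P[/eqP cov triv _] := block_partition x.
have /andP[_ /forall_inP ind] := valP (val x).
rewrite tog_block => st.
have /ind /forall_inP/(_ s) : block x s \in val (val x).
  by rewrite pblock_mem // cov.
by rewrite mem_pblock cov inE => /(_ isT) /forall_inP/(_ t st).
Qed.

Lemma block_imset x : val (val x) = [set block x s | s in [set: G]].
Proof.
have part := block_partition x; have /and3P[/eqP cov triv non0] := part.
apply/setP=> A; apply/idP/imsetP => [PA | [s _ ->]]; last first.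
  by rewrite pblock_mem // cov.
have /set0Pn[s sA] : A != set0 by apply: contraNneq non0 => <-.
by exists s; rewrite // /block (def_pblock triv PA sA).
Qed.

Lemma tog_inj x y : tog x =2 tog y -> x = y.
Proof.
move=> eqxy; apply: val_inj; apply: val_inj.
rewrite -(preim_partition_pblock (block_partition x)).
rewrite -(preim_partition_pblock (block_partition y)).
rewrite /preim_partition /equivalence_partition; apply: eq_imset => s.
by apply/setP=> t; rewrite !inE; apply: eqxy.
Qed.

(** Equality or adjacency in one notion, with a single vertex answering for every difference.
    Reflexivity needs a vertex of [G], hence the extra vertex argument of [near_far] and
    [not_near_neq]. *)
Definition near x y := exists v, forall s t, s != v -> t != v -> tog x s t = tog y s t.

Lemma mem_delete x v s t : s != v -> t != v ->
  tog x s t = [exists A in delete (val (val x)) v, (s \in A) && (t \in A)].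
Proof.
move=> sv tv; have /and3P[/eqP cov triv _] := block_partition x.
apply/idP/exists_inP => [| [A]].
  rewrite tog_block => st; exists (block x s :\ v); last first.
    by rewrite !inE sv tv st mem_pblock cov inE.
  rewrite !inE (imset_f (fun A : {set G} => A :\ v)) ?pblock_mem ?cov // andbT.
  by apply/set0Pn; exists t; rewrite !inE tv.
rewrite !inE => /andP[_ /imsetP[B PB ->]]; rewrite !inE sv tv /= => /andP[sB tB].
by rewrite /tog /block (def_pblock triv PB sB) (def_pblock triv PB tB).
Qed.

Lemma sub_delete x y v :
  (forall s t, s != v -> t != v -> tog x s t = tog y s t) ->
  delete (val (val x)) v \subset delete (val (val y)) v.
Proof.
have /and3P[/eqP covx trivx _] := block_partition x.
have /and3P[/eqP covy _ _] := block_partition y.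
move=> eqxy; apply/subsetP=> A; rewrite !inE => /andP[A0 /imsetP[B PB defA]].
rewrite A0 /=; have /set0Pn[s sA] := A0.
move: (sA); rewrite defA !inE => /andP[sv sB].
apply/imsetP; exists (block y s); first by rewrite pblock_mem ?covy.
have -> : B = block x s by rewrite /block (def_pblock trivx PB sB).
by apply/setP=> t; rewrite !inE; case: eqP => //= /eqP tv; rewrite -!tog_block eqxy.
Qed.

Lemma adjE x y : adj x y <-> x != y /\ near x y.
Proof.
have -> : adj x y = (val x != val y) &&
    [exists v, delete (val (val x)) v == delete (val (val y)) v] by [].
rewrite (inj_eq val_inj); split=> [/andP[nxy /existsP[v /eqP del]] | [nxy [v eqxy]]].
  by split; [|exists v => s t sv tv; rewrite !(mem_delete _ sv tv) del].
rewrite nxy /=; apply/existsP; exists v.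
by rewrite eqEsubset !sub_delete // => s t sv tv; rewrite eqxy.
Qed.

(** * Partitions as kernels of functions *)

Section Kernel.
Variables (K : eqType) (f : G -> K).
Hypothesis f_indep : forall s t, f s = f t -> ~~ adj s t.
Let r s t := f s == f t.

Lemma kernel_part : partition (preim_partition f [set: G]) [set: G].
Proof. exact: preim_partitionP. Qed.

Lemma kernel_block s : pblock (preim_partition f [set: G]) s = [set t | r s t].
Proof.
apply/setP=> t; rewrite inE.
apply: (@pblock_equivalence_partition _ r [set: G]); rewrite ?inE //.
by rewrite /r => t' u w _ _ _; split=> [|/eqP->]; rewrite ?eqxx.
Qed.

Lemma kernel_bell : indep_partition (preim_partition f [set: G]).
Proof.
apply/andP; split; first exact: kernel_part.
apply/forall_inP=> _ /imsetP[s _ ->]; apply/forall_inP=> t; rewrite !inE => st.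
apply/forall_inP=> u; rewrite !inE => su.
by apply: f_indep; rewrite -(eqP st) -(eqP su).
Qed.

Lemma kernel_tog : k <= #|preim_partition f [set: G]| ->
  {x : upper_bell k G | tog x =2 r}.
Proof.
move=> kP; pose P : bell G := exist _ (preim_partition f [set: G]) kernel_bell.
have PX : P \in [set P : bell G | k <= #|val P|] by rewrite inE.
exists (exist _ P PX : upper_bell k G) => s t.
by rewrite tog_block /block /= kernel_block inE.
Qed.

(** A refinement has at least as many parts: each part of [x] is hit by some part of the kernel.
    This is how new partitions are formed near one that may have exactly [k] parts. *)
Lemma kernel_refine x : (forall s t, f s = f t -> tog x s t) ->
  {y : upper_bell k G | tog y =2 r}.
Proof.
move=> fx; apply: kernel_tog; have := valP x; rewrite inE => /leq_trans; apply.
rewrite block_imset -[preim_partition _ _]/([set _ | s in _]).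
(* A kernel class goes to the part of [x] around any of its elements; [set0] is only a default, as
   kernel classes are nonempty. *)
pose h (A : {set G}) := if [pick s in A] is Some s then block x s else set0.
suff -> : [set block x s | s in [set: G]] =
    h @: (preim_partition f [set: G]) by exact: leq_imset_card.
rewrite -imset_comp; apply: eq_imset => s /=; rewrite /h.
case: pickP => [t|/(_ s)]; rewrite !inE ?eqxx // => /eqP /fx.
by move/eqP.
Qed.

(** The vertices other than [u] and [v] lie in pairwise different parts, so at least [n - 2] parts
    remain. The bound on [k] enters here. *)
Lemma kernel_near_discrete u v : k + 2 <= #|G| ->
  (forall s t, s \notin [set u; v] -> t \notin [set u; v] -> f s = f t -> s = t) ->
  {x : upper_bell k G | tog x =2 r}.
Proof.
move=> kG finj; apply: kernel_tog.
apply: leq_trans (_ : #|~: [set u; v]| <= _).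
  rewrite -(leq_add2r 2) (leq_trans kG) // -(cardsC [set u; v]) addnC leq_add2l cards2.
  by case: (_ != _).
pose h s := [set t in [set: G] | r s t].
rewrite -(@card_in_imset _ _ h); last first.
  move=> s t; rewrite !in_setC => su tu /setP/(_ t).
  by rewrite !inE /r eqxx => /eqP; apply: finj.
by apply: subset_leq_card; apply: imsetS; apply: subsetT.
Qed.

End Kernel.
End Togetherness.

(** * The all-singletons partition *)

Definition far (X : sgraph) (p r : X) := (r != p) && ~~ adj p r.

(* In each field, a vertex far from p and adjacent to two neighbours q, q' of p stands for the union of
   the edges q and q': two parts of size two if they are disjoint, a triangle otherwise. *)
Record rootlike (X : sgraph) (p : X) : Prop := Rootlike {
  square_ex : forall q q', adj p q -> adj p q' -> q != q' -> ~~ adj q q' ->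
    exists r, [/\ far p r, adj r q & adj r q'];
  square_uniq : forall q q' r r', adj p q -> adj p q' -> q != q' -> ~~ adj q q' ->
    far p r -> adj r q -> adj r q' -> far p r' -> adj r' q -> adj r' q' -> r = r';
  apex_adj : forall q q' g r, adj p q -> adj p q' -> adj p g -> adj q q' ->
    far p r -> adj r q -> adj r q' -> adj r g -> g = q \/ adj g q;
  prism : forall q f f' r r', adj p q -> adj p f -> adj p f' -> adj f f' ->
    q != f -> ~~ adj q f -> q != f' -> ~~ adj q f' ->
    far p r -> adj r q -> adj r f -> far p r' -> adj r' q -> adj r' f' ->
    r = r' \/ adj r r';
  triangle_touch : forall q q' q'' g r, adj p q -> adj p q' -> adj p q'' -> adj p g ->
    adj q q' -> adj q q'' -> adj q' q'' ->
    far p r -> adj r q -> adj r q' -> adj r q'' -> adj g q ->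
    [\/ g = q', g = q'', adj g q' | adj g q''] }.

(** * Edges of the complement *)

Definition coadj (G : sgraph) (u v : G) := (u != v) && ~~ adj u v.

Definition is_edge (G : sgraph) (e : {set G}) :=
  [exists u, exists v, coadj u v && (e == [set u; v])].

Section Edges.
Variable G : sgraph.
Implicit Types (e f : {set G}) (u v : G).

Lemma edgeP e : reflect (exists u v, coadj u v /\ e = [set u; v]) (is_edge e).
Proof.
apply: (iffP existsP) => [[u /existsP[v /andP[uv /eqP]]]|[u [v [uv ->]]]].
  by exists u, v.
by exists u; apply/existsP; exists v; rewrite uv eqxx.
Qed.

Lemma coadj_sym u v : coadj u v = coadj v u.
Proof. by rewrite /coadj eq_sym adj_sym. Qed.

Lemma edge2 u v : coadj u v -> is_edge [set u; v].
Proof. by move=> uv; apply/edgeP; exists u, v. Qed.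

Lemma edge_at e u : is_edge e -> u \in e -> exists2 v, coadj u v & e = [set u; v].
Proof.
case/edgeP=> a [b [ab ->]]; rewrite !inE => /orP[]/eqP->; first by exists b.
by exists a; rewrite 1?coadj_sym // setUC.
Qed.

Lemma edge_eq e u v : is_edge e -> u \in e -> v \in e -> u != v ->
  coadj u v /\ e = [set u; v].
Proof.
move=> ee /(edge_at ee)[w uw ->]; rewrite !inE => /orP[/eqP->|/eqP->] //.
by rewrite eqxx.
Qed.

Lemma edge_ex e : is_edge e -> exists u, u \in e.
Proof. by case/edgeP=> u [v [_ ->]]; exists u; rewrite !inE eqxx. Qed.

Definition meets e f := e :&: f != set0.

Lemma meetsP e f : reflect (exists2 v, v \in e & v \in f) (meets e f).
Proof.
apply: (iffP (set0Pn _)) => [[v]|[v ve vf]]; first by case/setIP; exists v.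
by exists v; apply/setIP.
Qed.

Lemma meets_sym e f : meets e f = meets f e. Proof. by rewrite /meets setIC. Qed.

Lemma meetsN e f v : ~~ meets e f -> v \in e -> v \notin f.
Proof. by move=> nm ve; apply: contra nm => vf; apply/meetsP; exists v. Qed.

End Edges.

(** * Neighbours of the all-singletons partition and their far common neighbours *)

Section Singletons.
Variables (G : sgraph) (k : nat).
Hypothesis kG : k + 2 <= #|G|.
Implicit Types (x y r : upper_bell k G) (s t u v : G) (e f : {set G}).

Definition discrete x := tog x =2 eq_op.
Definition merged x e := forall s t, tog x s t = (s == t) || (s \in e) && (t \in e).

Lemma discrete_ex : exists x, discrete x.
Proof.
have /card_gt0P[v _] : 0 < #|G| by rewrite (leq_trans _ kG) // addn2.
have [s t| | x hx] := @kernel_near_discrete G k G id _ v v kG; last by exists x.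
  by move=> ->; rewrite adj_irrefl.
by [].
Qed.

Lemma merged_ex e : is_edge e -> exists x, merged x e.
Proof.
case/edgeP=> u [v [/andP[nuv uv] ->]].
pose h s := if s == v then u else s.
have [s t||x hx] := @kernel_near_discrete G k G h _ u v kG.
- rewrite /h; case: (s =P v) => [->|_]; case: (t =P v) => [->|_] => //.
  + by rewrite adj_irrefl.
  + by move=> <-; rewrite adj_sym.
  + by move=> ->.
  + by move=> ->; rewrite adj_irrefl.
- move=> s t; rewrite !inE !negb_or /h => /andP[_ /negPf->] /andP[_ /negPf->] //.
exists x => s t; rewrite hx /h !inE.
case: (s =P v) => [->|sv]; case: (t =P v) => [->|tv]; rewrite ?eqxx ?orbT ?orbF ?andbT //.
- by rewrite [v == t]eq_sym (introF eqP tv) eq_sym.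
- by rewrite (introF eqP sv).
- by case: (s =P u) => [->|]; case: (t =P u) => [->|]; rewrite ?eqxx ?andbF ?orbF.
Qed.

Variable T : upper_bell k G.
Hypothesis discT : discrete T.

Lemma merged_adj_root x e : is_edge e -> merged x e -> adj T x.
Proof.
case/edgeP=> u [v [/andP[nuv _] ->]] xe; apply/adjE; split.
  apply/eqP=> xT; have := xe u v; rewrite -xT discT (negPf nuv) !inE !eqxx orbT.
  by [].
exists v => s t sv tv; rewrite discT xe !inE (negPf sv) (negPf tv) !orbF.
by case: (s =P u) => [->|]; rewrite ?orbF //= eq_sym orbb.
Qed.

(** Vertices other than the changed [z] stay apart from each other, so [z] has at most one
    companion, and exactly one because [x] differs from [T]. *)
Lemma adj_root_merged x : adj T x -> exists2 e, is_edge e & merged x e.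
Proof.
case/adjE=> nTx [z Tx].
have key s : s != z -> tog x z s -> exists2 e, is_edge e & merged x e.
  move=> sz zs; have cad : coadj z s by rewrite /coadj eq_sym sz (tog_indep zs).
  exists [set z; s]; first exact: edge2.
  have zE t : t != z -> tog x z t = (t == s).
    move=> tz; apply/idP/eqP=> [zt|->//]; apply/eqP; rewrite -discT Tx //.
    by rewrite (tog_trans _ zs) // tog_sym.
  move=> t u; rewrite !inE; case: (eqVneq t z) => [->|tz] /=.
    case: (eqVneq u z) => [->|uz]; first by rewrite tog_refl ?eqxx.
    by rewrite zE // eq_sym (negPf uz).
  case: (eqVneq u z) => [->|uz] /=; first by rewrite tog_sym zE // (negPf tz) andbT.
  rewrite -Tx // discT; case: (t =P s) => [->|]; rewrite ?orbF //= eq_sym.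
  by rewrite orbb.
case: (boolP [exists s, (s != z) && tog x z s]) => [/existsP[s /andP[]]|]; first exact: key.
rewrite negb_exists => /forallP none; case/eqP: nTx; apply: tog_inj => s t.
rewrite discT; case: (eqVneq s z) => [->|sz].
  case: (eqVneq t z) => [->|tz]; first by rewrite tog_refl.
  by have := none t; rewrite tz /= => /negPf->.
case: (eqVneq t z) => [->|tz].
  by have := none s; rewrite sz /= tog_sym (negPf sz) => /negPf->.
by rewrite -Tx // discT.
Qed.

Lemma merged_uniq x y e : merged x e -> merged y e -> x = y.
Proof. by move=> xe ye; apply: tog_inj => s t; rewrite xe ye. Qed.

Lemma merged_inj x e f : is_edge e -> is_edge f -> merged x e -> merged x f -> e = f.
Proof.
case/edgeP=> u [v [/andP[nuv _] ->]] ef xe xf.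
have := xf u v; rewrite xe !inE !eqxx orbT (negPf nuv) /= => /esym/andP[uf vf].
by have [_ ->] := edge_eq ef uf vf nuv.
Qed.

Lemma merged_agree_meets x y z e f : is_edge e -> merged x e -> merged y f -> z \notin e ->
  (forall s t, s != z -> t != z -> tog x s t = tog y s t) -> meets e f.
Proof.
move=> ee xe yf ze xy; have [u [v [/andP[nuv _] eE]]] := edgeP _ ee.
have ue : u \in e by rewrite eE !inE eqxx.
have ve : v \in e by rewrite eE !inE eqxx orbT.
have uz : u != z by apply: contraNneq ze => <-.
have vz : v != z by apply: contraNneq ze => <-.
have := xy u v uz vz; rewrite xe yf ue ve orbT (negPf nuv) /= => /esym/andP[uf _].
by apply/meetsP; exists u.
Qed.

Lemma merged_adj x y e f : is_edge e -> is_edge f -> merged x e -> merged y f -> x != y ->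
  adj x y = meets e f.
Proof.
move=> ee ef xe yf nxy; apply/idP/meetsP => [/adjE[_ [z xy]] | [v ve vf]].
  apply/meetsP; have [ze|ze] := boolP (z \in e); last exact: merged_agree_meets ze xy.
  have [zf|zf] := boolP (z \in f); first by apply/meetsP; exists z.
  rewrite meets_sym; apply: (merged_agree_meets ef yf xe zf) => s t sz tz.
  by rewrite xy.
apply/adjE; split=> //; exists v => s t sv tv; rewrite xe yf.
have [u _ ->] := edge_at ee ve; have [w _ ->] := edge_at ef vf.
rewrite !inE (negPf sv) (negPf tv) /=; case: (eqVneq s t) => //= nst.
by case: (s =P u) => [?|_]; case: (t =P u) => [?|_]; case: (s =P w) => [?|_];
  case: (t =P w) => [?|_] //; subst; rewrite eqxx in nst.
Qed.

Lemma far_near r : far T r -> ~ near T r.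
Proof. by case/andP=> rT /negP nTr Tr; apply: nTr; apply/adjE; rewrite eq_sym. Qed.

Lemma near_far r v : ~ near T r -> far T r.
Proof.
move=> nr; apply/andP; split; last by apply/negP=> /adjE[].
by apply: contra_notN nr => /eqP->; exists v.
Qed.

(** If the change between [r] and [x] took place at an end of [e], then deleting that vertex would
    also undo [e], and [r] would be near [T]. *)
Lemma far_adj r x e : is_edge e -> merged x e -> far T r -> adj r x ->
  exists2 z, z \notin e & forall s t, s != z -> t != z -> tog r s t = tog x s t.
Proof.
move=> ee xe /far_near nr /adjE[_ [z rx]]; exists z => //.
apply/negP=> ze; apply: nr; exists z => s t sz tz; rewrite rx // xe discT.
have [u _ ->] := edge_at ee ze; rewrite !inE (negPf sz) (negPf tz) /=.
by case: (s =P u) => [->|]; rewrite ?orbF //= eq_sym orbb.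
Qed.

Lemma far_adj_sub r x e : is_edge e -> merged x e -> far T r -> adj r x ->
  forall s t, s \in e -> t \in e -> tog r s t.
Proof.
move=> ee xe fr rx s t se te; have [z ze rz] := far_adj ee xe fr rx.
rewrite rz ?xe ?se ?te ?orbT //; by apply: contraNneq ze => <-.
Qed.

(** As [f] is joined in [r] but not in [x], the change from [x] is at an end [z] of [f]; likewise
    the change from [y] is at an end [w] of [e]. If [z] and [w] were together, so would be [z] and
    the other end of [e], which the agreement with [y] off [w] forbids. *)
Lemma far_disjoint r x y e f : is_edge e -> is_edge f -> merged x e -> merged y f ->
  ~~ meets e f -> far T r -> adj r x -> adj r y ->
  forall s t, tog r s t = [|| s == t, (s \in e) && (t \in e) | (s \in f) && (t \in f)].
Proof.
move=> ee ef xe yf nm fr rx ry; have nm' := nm; rewrite meets_sym in nm'.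
have re := far_adj_sub ee xe fr rx; have rf := far_adj_sub ef yf fr ry.
have [z ze rz] := far_adj ee xe fr rx; have [w wf rw] := far_adj ef yf fr ry.
have zf : z \in f.
  apply: contraT => zf; have [c [d [/andP[ncd _] fE]]] := edgeP _ ef.
  have cf : c \in f by rewrite fE !inE eqxx.
  have df : d \in f by rewrite fE !inE eqxx orbT.
  have := rf c d cf df; rewrite rz ?xe ?(negPf ncd) ?(negPf (meetsN nm' cf)) //.
  - by apply: contraNneq zf => <-.
  - by apply: contraNneq zf => <-.
have we : w \in e.
  apply: contraT => we; have [c [d [/andP[ncd _] eE]]] := edgeP _ ee.
  have ce : c \in e by rewrite eE !inE eqxx.
  have de : d \in e by rewrite eE !inE eqxx orbT.
  have := re c d ce de; rewrite rw ?yf ?(negPf ncd) ?(negPf (meetsN nm ce)) //.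
  - by apply: contraNneq we => <-.
  - by apply: contraNneq we => <-.
have nzw : z != w by apply: contraNneq wf => <-.
have rzw : tog r z w = false.
  apply/negP=> zw; have [b /andP[nwb _] eE] := edge_at ee we.
  have be : b \in e by rewrite eE !inE eqxx orbT.
  have := tog_trans zw (re _ _ we be).
  rewrite rw // 1?eq_sym // yf (negPf (meetsN nm be)) andbF orbF => /eqP zb.
  by rewrite zb be in ze.
have rzE t : tog r z t = (z == t) || (t \in f).
  case: (eqVneq t w) => [->|tw]; first by rewrite rzw (negPf nzw) (negPf wf).
  by rewrite rw // yf zf.
move=> s t; case: (eqVneq s z) => [->|sz]; first by rewrite rzE (negPf ze) zf.
case: (eqVneq t z) => [->|tz].
  by rewrite tog_sym rzE (negPf ze) zf andbF andbT eq_sym.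
rewrite rz // xe; have [d _ ->] := edge_at ef zf.
rewrite !inE (negPf sz) (negPf tz) /=; case: (eqVneq s t) => //= nst.
by case: (s =P d) => [?|_]; case: (t =P d) => [?|_]; rewrite ?orbF //; subst;
  rewrite eqxx in nst.
Qed.

(** Both changes are forced: [x] has to gain the end [b] of [f] and [y] the end [a] of [e], so the
    two edges become one part of three vertices. *)
Lemma far_meet r x y e f : is_edge e -> is_edge f -> merged x e -> merged y f ->
  meets e f -> x != y -> far T r -> adj r x -> adj r y ->
  forall s t, tog r s t = (s == t) || (s \in e :|: f) && (t \in e :|: f).
Proof.
move=> ee ef xe yf /meetsP[v ve vf] nxy fr rx ry.
have re := far_adj_sub ee xe fr rx; have rf := far_adj_sub ef yf fr ry.
have [z ze rz] := far_adj ee xe fr rx; have [w wf rw] := far_adj ef yf fr ry.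
have [a /andP[nva _] eE] := edge_at ee ve; have [b /andP[nvb _] fE] := edge_at ef vf.
have nab : a != b.
  apply: contraNneq nxy => ab; apply/eqP; apply: (merged_uniq xe).
  by rewrite eE ab -fE.
have ae : a \in e by rewrite eE !inE eqxx orbT.
have bf : b \in f by rewrite fE !inE eqxx orbT.
have zb : z = b.
  apply: contraTeq (rf v b vf bf) => zb; rewrite rz //; last by rewrite eq_sym.
    rewrite xe (negPf nvb) ve eE !inE eq_sym (negPf nvb) eq_sym (negPf nab).
    by [].
  by apply: contraNneq ze => <-.
have wa : w = a.
  apply: contraTeq (re v a ve ae) => wa; rewrite rw //; last by rewrite eq_sym.
    by rewrite yf (negPf nva) vf fE !inE eq_sym (negPf nva) (negPf nab).
  by apply: contraNneq wf => <-.
subst z w; move=> s t.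
have rb u : tog r b u = (b == u) || (u \in e :|: f).
  case: (eqVneq u a) => [->|ua].
    by rewrite inE ae orbT (tog_trans (rf b v bf vf) (re v a ve ae)).
  rewrite (rw _ _ _ ua) ?yf ?bf; last by rewrite eq_sym.
  rewrite eE fE !inE (negPf ua) [b == u]eq_sym /=.
  by case: (u == v); case: (u == b).
case: (eqVneq s b) => [->|sb]; first by rewrite rb !inE bf orbT.
case: (eqVneq t b) => [->|tb]; first by rewrite tog_sym rb !inE bf orbT andbT eq_sym.
rewrite rz // xe !inE fE !inE (negPf sb) (negPf tb) !orbF.
by case: (s =P v) => [->|]; case: (t =P v) => [->|]; rewrite ?ve ?orbF ?orbT.
Qed.

End Singletons.

(** * The all-singletons partition is rootlike *)

Section Root.
Variables (G : sgraph) (k : nat).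
Hypothesis kG : k + 2 <= #|G|.
Variable T : upper_bell k G.
Hypothesis discT : discrete T.
Implicit Types (x y r : upper_bell k G) (s t u v : G) (e f : {set G}).

Lemma adj_neq (X : sgraph) (p q : X) : adj p q -> p != q.
Proof. by apply: contraTneq => ->; rewrite adj_irrefl. Qed.

Lemma square_vertex e f : is_edge e -> is_edge f -> ~~ meets e f ->
  exists r, forall s t,
    tog r s t = [|| s == t, (s \in e) && (t \in e) | (s \in f) && (t \in f)].
Proof.
move=> ee ef nm; have nef := meetsN nm.
have nfe v : v \in f -> v \notin e by apply: meetsN; rewrite meets_sym.
have [a [b [ab eE]]] := edgeP _ ee; have [c [d [cd fE]]] := edgeP _ ef.
have ae : a \in e by rewrite eE !inE eqxx.
have cf : c \in f by rewrite fE !inE eqxx.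
pose h s := if s \in e then a else if s \in f then c else s.
have hE s t : (h s == h t) = [|| s == t, (s \in e) && (t \in e) | (s \in f) && (t \in f)].
  have [->|nst] /= := eqVneq s t; first by rewrite eqxx.
  have nac : a != c by apply: contraTneq ae => ->; apply: nfe.
  rewrite /h; case se: (s \in e); case te: (t \in e); rewrite ?eqxx //=.
  - rewrite (negPf (nef _ se)) /=; case tf: (t \in f); apply/negbTE => //.
    by apply: contraFneq te => <-.
  - rewrite (negPf (nef _ te)) /= andbF; case sf: (s \in f); apply/negbTE => //.
      by rewrite eq_sym.
    by apply: contraFneq se => ->.
  - case sf: (s \in f); case tf: (t \in f); rewrite ?eqxx //=; apply/negbTE => //.
      by apply: contraFneq tf => <-.
    by apply: contraFneq sf => ->.
have [s t /eqP|s t|x hx] := @kernel_near_discrete G k G h _ b d kG.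
- rewrite hE => /or3P[/eqP->|/andP[se te]|/andP[sf tf]]; first by rewrite adj_irrefl.
    have [->|nst] := eqVneq s t; first by rewrite adj_irrefl.
    by have [/andP[]] := edge_eq ee se te nst.
  have [->|nst] := eqVneq s t; first by rewrite adj_irrefl.
  by have [/andP[]] := edge_eq ef sf tf nst.
- rewrite !inE !negb_or => /andP[sb sd] /andP[tb td] /eqP.
  rewrite hE eE fE !inE (negPf sb) (negPf sd) (negPf tb) (negPf td) !orbF.
  by case/or3P=> [/eqP|/andP[/eqP-> /eqP->]|/andP[/eqP-> /eqP->]].
by exists x => s t; rewrite hx hE.
Qed.

Lemma triangle_vertex u v w : coadj u v -> coadj u w -> coadj v w ->
  exists r, forall s t,
    tog r s t = (s == t) || (s \in [set u; v; w]) && (t \in [set u; v; w]).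
Proof.
move=> uv uw vw; pose h s := if s \in [set u; v; w] then u else s.
have hE s t : (h s == h t) = (s == t) || (s \in [set u; v; w]) && (t \in [set u; v; w]).
  have [->|nst] /= := eqVneq s t; first by rewrite eqxx.
  have uu : u \in [set u; v; w] by rewrite !inE eqxx.
  rewrite /h; case su: (s \in _); case tu: (t \in _); rewrite ?eqxx //=.
  - by apply: contraFF tu => /eqP<-.
  - by apply: contraFF su => /eqP->.
  - exact: negPf.
have [s t /eqP|s t|x hx] := @kernel_near_discrete G k G h _ v w kG.
- have [[_ uv'] [_ uw'] [_ vw']] := And3 (andP uv) (andP uw) (andP vw).
  rewrite hE !inE => /orP[/eqP->|]; first by rewrite adj_irrefl.
  move=> /andP[/orP[/orP[]|] /eqP-> /orP[/orP[]|] /eqP->]; by rewrite ?adj_irrefl // adj_sym.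
- rewrite !inE !negb_or => /andP[sb sd] /andP[tb td] /eqP.
  rewrite hE !inE (negPf sb) (negPf sd) (negPf tb) (negPf td) !orbF.
  by case/orP=> [/eqP|/andP[/eqP-> /eqP->]].
by exists x => s t; rewrite hx hE.
Qed.

(** Whichever vertex is deleted, two vertices of the triangle remain that are together in [r] but
    apart in [T]. *)
Lemma triangle_far u v w r : coadj u v -> coadj u w -> coadj v w ->
  (forall s t, tog r s t = (s == t) || (s \in [set u; v; w]) && (t \in [set u; v; w])) ->
  far T r.
Proof.
move=> /andP[uv _] /andP[uw _] /andP[vw _] rE; apply: (near_far u).
case=> z Tr.
have key s t : s \in [set u; v; w] -> t \in [set u; v; w] -> s != t ->
    s != z -> t != z -> False.
  by move=> su tu nst sz tz; have := Tr s t sz tz; rewrite discT rE su tu (negPf nst).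
have [uI vI wI] : [/\ u \in [set u; v; w], v \in [set u; v; w] & w \in [set u; v; w]].
  by rewrite !inE !eqxx !orbT.
have [uz|uz] := eqVneq u z; first by apply: (key v w); rewrite // -uz eq_sym.
have [vz|vz] := eqVneq v z; first by apply: (key u w); rewrite // -vz eq_sym.
exact: (key u v).
Qed.

Lemma triangle_adj u v w r x : coadj u v -> coadj u w -> coadj v w ->
  (forall s t, tog r s t = (s == t) || (s \in [set u; v; w]) && (t \in [set u; v; w])) ->
  merged x [set u; v] -> adj r x.
Proof.
move=> /andP[uv _] /andP[uw _] /andP[vw _] rE xe; apply/adjE; split.
  apply/eqP=> rx; have := rE u w; rewrite rx xe !inE !eqxx !orbT (negPf uw) /=.
  by rewrite eq_sym (negPf uw) eq_sym (negPf vw).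
by exists w => s t sw tw; rewrite rE xe !inE (negPf sw) (negPf tw) !orbF.
Qed.

Lemma rootlike_discrete : rootlike T.
Proof.
split.
- move=> q q' /(adj_root_merged discT)[e ee qe] /(adj_root_merged discT)[f ef qf] nqq.
  rewrite (merged_adj ee ef qe qf nqq) => nm.
  have [r rE] := square_vertex ee ef nm; exists r.
  have nef := meetsN nm.
  have nfe v : v \in f -> v \notin e by apply: meetsN; rewrite meets_sym.
  have [a [b [/andP[ab _] eE]]] := edgeP _ ee.
  have [c [d [/andP[cd _] fE]]] := edgeP _ ef.
  have [ae be] : a \in e /\ b \in e by rewrite eE !inE !eqxx orbT.
  have [cf df] : c \in f /\ d \in f by rewrite fE !inE !eqxx orbT.
  split.
  (* No [z] lies in both edges, so one of them survives the deletion of [z]. *)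
  + apply: (near_far a) => -[z Tr].
    have [zf|zf] := boolP (z \in f).
      have az : a != z by apply: contraTneq zf => <-; apply: nef.
      have bz : b != z by apply: contraTneq zf => <-; apply: nef.
      by have := Tr a b az bz; rewrite discT rE ae be orbT (negPf ab).
    have cz : c != z by apply: contraNneq zf => <-.
    have dz : d != z by apply: contraNneq zf => <-.
    by have := Tr c d cz dz; rewrite discT rE cf df !orbT (negPf cd).
  + apply/adjE; split.
      apply/eqP=> rq; have := rE c d; rewrite rq qe cf df (negPf cd) !orbT.
      by rewrite (negPf (nfe _ cf)).
    exists d => s t sd td; rewrite rE qe fE !inE (negPf sd) (negPf td) !orbF.
    by case: (s =P c) => [->|]; case: (t =P c) => [->|]; rewrite ?eqxx ?andbF ?orbF.
  + apply/adjE; split.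
      apply/eqP=> rq; have := rE a b; rewrite rq qf ae be (negPf ab) !orbT.
      by rewrite (negPf (nef _ ae)).
    exists b => s t sb tb; rewrite rE qf eE !inE (negPf sb) (negPf tb) !orbF.
    by case: (s =P a) => [->|]; case: (t =P a) => [->|]; rewrite ?eqxx ?andbF ?orbF.
- move=> q q' r r' /(adj_root_merged discT)[e ee qe] /(adj_root_merged discT)[f ef qf] nqq.
  rewrite (merged_adj ee ef qe qf nqq) => nm fr rq rq' fr' rq1 rq1'.
  apply: tog_inj => s t.
  by rewrite (far_disjoint discT ee ef qe qf nm fr) // (far_disjoint discT ee ef qe qf nm fr').
- move=> q q' g r /(adj_root_merged discT)[e ee qe] /(adj_root_merged discT)[f ef qf].
  move=> /(adj_root_merged discT)[e' ee' ge] qq' fr rq rq' rg.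
  have nqq' := adj_neq qq'; move: qq'; rewrite (merged_adj ee ef qe qf) // => mef.
  have rE := far_meet discT ee ef qe qf mef nqq' fr rq rq'.
  have re := far_adj_sub discT ee' ge fr rg.
  have [->|ngq] := eqVneq g q; [by left|right].
  rewrite (merged_adj ee' ee ge qe) //.
  have [v ve vf] := meetsP _ _ mef; have [w _ fE] := edge_at ef vf.
  have [a [b [/andP[ab _] e'E]]] := edgeP _ ee'.
  have [ae be] : a \in e' /\ b \in e' by rewrite e'E !inE !eqxx orbT.
  (* The ends of [e'] lie in [e :|: f]. If neither is in [e], then [e' = f], which meets [e]. *)
  have := re a b ae be; rewrite rE (negPf ab) /= !(in_setU _ e f) => /andP[].
  case/orP=> [ae1|af]; first by move=> _; apply/meetsP; exists a.
  case/orP=> [be1|bf]; first by apply/meetsP; exists b.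
  have [_ fE'] := edge_eq ef af bf ab.
  apply/meetsP; exists v; rewrite // e'E -fE'.
  by [].
- move=> q f f' r r' /(adj_root_merged discT)[e ee qe] /(adj_root_merged discT)[e1 ee1 fe1].
  move=> /(adj_root_merged discT)[e2 ee2 fe2] ff' nqf aqf nqf' aqf' fr rq rf fr' rq' rf'.
  rewrite (merged_adj ee ee1 qe fe1) // in aqf; rewrite (merged_adj ee ee2 qe fe2) // in aqf'.
  have nff := adj_neq ff'; move: ff'; rewrite (merged_adj ee1 ee2 fe1 fe2) //.
  move=> /meetsP[v v1 v2].
  have rE := far_disjoint discT ee ee1 qe fe1 aqf fr rq rf.
  have rE' := far_disjoint discT ee ee2 qe fe2 aqf' fr' rq' rf'.
  have [->|nrr] := eqVneq r r'; [by left | right; apply/adjE; split=> //].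
  (* The two squares share [e] and exchange [e1] for [e2], which is a change at the common end [v]
     of these. *)
  exists v => s t sv tv; rewrite rE rE'.
  have [a _ ->] := edge_at ee1 v1; have [b _ ->] := edge_at ee2 v2.
  rewrite !inE (negPf sv) (negPf tv) /=; have [//|nst] := eqVneq s t => /=.
  by congr orb; apply/idP/idP=> /andP[/eqP sE /eqP tE]; rewrite sE tE eqxx in nst.
- move=> q q' q'' g r /(adj_root_merged discT)[e ee qe] /(adj_root_merged discT)[f ef qf].
  move=> /(adj_root_merged discT)[h eh qh] /(adj_root_merged discT)[i ei gi].
  move=> qq' qq'' q'q'' fr rq rq' rq'' gq.
  have [nqq' nqq'' nq'q'' ngq] := And4 (adj_neq qq') (adj_neq qq'') (adj_neq q'q'') (adj_neq gq).
  move: qq' gq; rewrite (merged_adj ee ef qe qf) // (merged_adj ei ee gi qe) // => mef.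
  have [->|ngq'] := eqVneq g q'; first by constructor 1.
  have [->|ngq''] := eqVneq g q''; first by constructor 2.
  rewrite (merged_adj ei ef gi qf) // (merged_adj ei eh gi qh) // => mie.
  have rE := far_meet discT ee ef qe qf mef nqq' fr rq rq'.
  have re := far_adj_sub discT eh qh fr rq''.
  have [v ve vf] := meetsP _ _ mef.
  have [u uv eE] := edge_at ee ve; have [w vw fE] := edge_at ef vf.
  case/meetsP: mie => z zi; rewrite eE !inE => /orP[/eqP zv|/eqP zu].
    by constructor 3; apply/meetsP; exists z; rewrite // zv.
  have [zf|zf] := boolP (z \in f); first by constructor 3; apply/meetsP; exists z.
  constructor 4; apply/meetsP; exists z => //; apply: contraT => zh.
  (* If [h] misses [z = u], the end of [e] outside [f], then both its ends lie in [f] and [h = f],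
     although [q'] and [q''] differ. *)
  have hf a : a \in h -> a \in f.
    move=> ah; have [b /andP[ab _] hE] := edge_at eh ah.
    have bh : b \in h by rewrite hE !inE eqxx orbT.
    have := re a b ah bh; rewrite rE (negPf ab) /= !(in_setU _ e f) => /andP[].
    case/orP=> // ; rewrite eE !inE => /orP[/eqP->|/eqP au] // .
    by rewrite zu -au ah in zh.
  have [a [b [/andP[ab _] hE]]] := edgeP _ eh.
  have [ah bh] : a \in h /\ b \in h by rewrite hE !inE !eqxx orbT.
  have [_ fE'] := edge_eq ef (hf _ ah) (hf _ bh) ab.
  case/negP: nq'q''; apply/eqP; apply: (merged_uniq qf).
  by rewrite fE' -hE.
Qed.

End Root.

Lemma rootlike_iso (X Y : sgraph) (phi : X -> Y) (p : X) :
  bijective phi -> {mono phi : x y / adj x y} -> rootlike p -> rootlike (phi p).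
Proof.
move=> [psi phiK psiK] phiA.
have phi_eq x y : (phi x == phi y) = (x == y) by exact: can_eq.
have farE x y : far (phi x) (phi y) = far x y by rewrite /far phi_eq phiA.
case=> h1 h2 h3 h4 h5; split.
- move=> q q'; rewrite -(psiK q) -(psiK q') !phiA phi_eq => a b c d.
  by have [r [? ? ?]] := h1 _ _ a b c d; exists (phi r); rewrite farE !phiA.
- move=> q q' r r'.
  rewrite -(psiK q) -(psiK q') -(psiK r) -(psiK r') !farE !phiA phi_eq => *.
  by congr phi; apply: (h2 (psi q) (psi q')).
- move=> q q' g r; rewrite -(psiK q) -(psiK q') -(psiK g) -(psiK r) !farE !phiA => *.
  by case: (h3 (psi q) (psi q') (psi g) (psi r)) => // [->|?]; [left|right].
- move=> q f f' r r'; rewrite -(psiK q) -(psiK f) -(psiK f') -(psiK r) -(psiK r').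
  rewrite !farE !phiA !phi_eq => *.
  by case: (h4 (psi q) (psi f) (psi f') (psi r) (psi r')) => // [->|?]; [left|right].
- move=> q q' q'' g r.
  rewrite -(psiK q) -(psiK q') -(psiK q'') -(psiK r) -(psiK g) !farE !phiA => *.
  case: (h5 (psi q) (psi q') (psi q'') (psi g) (psi r)) => // [->|->|?|?];
  by [constructor 1|constructor 2|constructor 3|constructor 4].
Qed.

(** * Moves from a rootlike partition *)

Section Moves.
Variables (G : sgraph) (k : nat).
Implicit Types (x y q r : upper_bell k G) (s t u v : G).

Lemma refine_ex (K : eqType) x (f : G -> K) :
  exists y, forall s t, tog y s t = tog x s t && (f s == f t).
Proof.
pose h s := (block x s, f s).
have [s t [st _]|s t [st _]|y hy] := @kernel_refine G k _ h _ x.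
- by apply: (@tog_indep _ _ x); rewrite /tog st.
- by rewrite /tog st.
by exists y => s t; rewrite hy xpair_eqE.
Qed.

Lemma diff_at x y z s t :
  (forall s t, s != z -> t != z -> tog x s t = tog y s t) ->
  tog x s t != tog y s t -> (z == s) || (z == t).
Proof.
move=> xy; apply: contraR; rewrite negb_or ![z == _]eq_sym => /andP[sz tz].
by rewrite xy.
Qed.

Lemma adj_by x y z s t : tog x s t != tog y s t ->
  (forall s t, s != z -> t != z -> tog x s t = tog y s t) -> adj x y.
Proof.
move=> nst xy; apply/adjE; split; last by exists z.
by apply: contraNneq nst => ->.
Qed.

(** A changed vertex lies in every pair on which the two partitions disagree, so two disjoint such
    pairs leave no room for it. The triangle and path variants work in the same way. *)
Lemma not_near_disjoint x y a b c d :
  tog x a b != tog y a b -> tog x c d != tog y c d ->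
  a != c -> a != d -> b != c -> b != d -> ~ near x y.
Proof.
move=> ab cd ac ad bc bd [z xy].
by have := diff_at xy ab; have := diff_at xy cd => /orP[]/eqP-> /orP[]/eqP zE;
  subst; rewrite eqxx in ac ad bc bd.
Qed.

Lemma not_near_triangle x y a b c :
  tog x a b != tog y a b -> tog x a c != tog y a c -> tog x b c != tog y b c ->
  a != b -> a != c -> b != c -> ~ near x y.
Proof.
move=> ab ac bc nab nac nbc [z xy].
have := diff_at xy ab; have := diff_at xy ac; have := diff_at xy bc.
by move=> /orP[]/eqP-> /orP[]/eqP zE /orP[]/eqP zE'; subst;
  rewrite eqxx in nab nac nbc.
Qed.

Lemma not_near_neq x y s : ~ near x y -> x != y.
Proof. by apply: contra_notN => /eqP->; exists s. Qed.

Lemma not_near_adj x y : ~ near x y -> ~~ adj x y.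
Proof. by move=> nxy; apply/negP=> /adjE[]. Qed.

Lemma eq_both a b s : a != b -> (s == a) && (s == b) = false.
Proof. by move=> ab; case: eqP => [->|//]; rewrite (negPf ab). Qed.

Variable P : upper_bell k G.
Hypothesis rootP : rootlike P.

(* Pulling a and b out of a part a, b, c, d of size at least 4 can be completed in two ways, a|b|cd and
   ab|cd, which contradicts square_uniq. *)
Lemma class_le3 a b c d : uniq [:: a; b; c; d] ->
  tog P a b -> tog P a c -> tog P a d -> False.
Proof.
rewrite /= !inE !negb_or -!andbA => /and5P[ab ac ad bc /and3P[bd cd _]] Pab Pac Pad.
have [ba ca da] : [/\ b != a, c != a & d != a] by split; rewrite eq_sym.
have [cb db] : c != b /\ d != b by split; rewrite eq_sym.
have Pbc : tog P b c by rewrite (tog_trans _ Pac) // tog_sym.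
have Pbd : tog P b d by rewrite (tog_trans _ Pad) // tog_sym.
have [qa qaE] := refine_ex P (fun s => s == a).
have [qb qbE] := refine_ex P (fun s => s == b).
have [r rE] := refine_ex P (fun s => (s == a, s == b)).
have [r' r'E] := refine_ex P (fun s => (s == a) || (s == b)).
have E := (Pab, Pac, Pad, Pbc, Pbd, eqxx, negPf ab, negPf ac, negPf ad, negPf bc,
  negPf bd, negPf ba, negPf ca, negPf da, negPf cb, negPf db).
have Pqa : adj P qa.
  apply: (@adj_by _ _ a a b); first by rewrite qaE !E.
  by move=> s t sa ta; rewrite qaE (negPf sa) (negPf ta) andbT.
have Pqb : adj P qb.
  apply: (@adj_by _ _ b a b); first by rewrite qbE !E.
  by move=> s t sb tb; rewrite qbE (negPf sb) (negPf tb) andbT.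
have nqq : ~ near qa qb.
  by apply: (@not_near_disjoint _ _ a c b d); rewrite // qaE qbE !E.
have rqa : adj r qa.
  apply: (@adj_by _ _ b b c); first by rewrite rE qaE !xpair_eqE !E.
  by move=> s t sb tb; rewrite rE qaE xpair_eqE (negPf sb) (negPf tb) andbT.
have rqb : adj r qb.
  apply: (@adj_by _ _ a a c); first by rewrite rE qbE !xpair_eqE !E.
  by move=> s t sa ta; rewrite rE qbE xpair_eqE (negPf sa) (negPf ta).
have rqa' : adj r' qa.
  apply: (@adj_by _ _ b b c); first by rewrite r'E qaE !E.
  by move=> s t sb tb; rewrite r'E qaE (negPf sb) (negPf tb) !orbF.
have rqb' : adj r' qb.
  apply: (@adj_by _ _ a a c); first by rewrite r'E qbE !E.
  by move=> s t sa ta; rewrite r'E qbE (negPf sa) (negPf ta).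
have fr : far P r.
  apply: (near_far a); apply: (@not_near_disjoint _ _ a c b d) => //.
    by rewrite rE xpair_eqE !E.
  by rewrite rE xpair_eqE !E.
have fr' : far P r'.
  by apply: (near_far a); apply: (@not_near_disjoint _ _ a c b d); rewrite // r'E !E.
have rr' := square_uniq rootP Pqa Pqb (not_near_neq a nqq) (not_near_adj nqq)
  fr rqa rqb fr' rqa' rqb'.
by have := rE a b; rewrite rr' r'E xpair_eqE !E.
Qed.

Definition class a (l : seq G) := forall t, tog P a t = (t \in l).

Lemma class_mem a l s t : class a l -> tog P s t -> (s \in l) = (t \in l).
Proof.
move=> al st; rewrite -!al; apply/idP/idP => /tog_trans; apply=> //.
by rewrite tog_sym.
Qed.

Lemma class_cases a :
  [\/ class a [:: a], exists2 b, a != b & class a [:: a; b] |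
      exists b c, uniq [:: a; b; c] /\ class a [:: a; b; c]].
Proof.
have ext l : all (tog P a) l -> (exists2 d, d \notin l & tog P a d) \/ class a l.
  move=> /allP al.
  have [/existsP[d /andP[dl ad]]|] := boolP [exists d, (d \notin l) && tog P a d].
    by left; exists d.
  rewrite negb_exists => /forallP none; right=> t; apply/idP/idP=> [at_|]; last exact: al.
  by have := none t; rewrite at_ andbT negbK.
have [|[b ba ab]|] := ext [:: a]; first by rewrite /= tog_refl.
  have nab : a != b by move: ba; rewrite inE eq_sym.
  have [|[c ca ac]|] := ext [:: a; b]; first by rewrite /= tog_refl ab.
    have abc : uniq [:: a; b; c].
      move: ca; rewrite /= !inE !negb_or nab ![c == _]eq_sym => /andP[-> ->].
      by [].
    have [|[d da ad]|] := ext [:: a; b; c]; first by rewrite /= tog_refl ab ac.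
      case: (@class_le3 a b c d) => //; rewrite -[[:: a; _; _; _]]/(rcons [:: a; b; c] d).
      by rewrite rcons_uniq da abc.
    by constructor 3; exists b, c.
  by constructor 2; exists b.
by constructor 1.
Qed.

(** One companion [w] suffices: by transitivity the new part of [v] is that of [w] with [v] added,
    so [q] is determined ([movesE], [moves_eq]). *)
Definition moves q v w :=
  [/\ ~~ tog P v w, tog q v w &
    forall s t, s != v -> t != v -> tog q s t = tog P s t].

Lemma moves_neq q v w : moves q v w -> v != w.
Proof. by case=> nP _ _; apply: contraNneq nP => ->; apply: tog_refl. Qed.

Lemma movesE q v w t : moves q v w -> t != v -> tog q v t = tog P w t.
Proof.
move=> mq tv; have vw := moves_neq mq; have [_ qvw qP] := mq.
rewrite -qP // 1?[_ == v]eq_sym //; apply/idP/idP; last exact: (tog_trans qvw).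
by apply: tog_trans; rewrite tog_sym.
Qed.

Lemma moves_adj q v w : moves q v w -> adj P q.
Proof.
case=> nP qvw qP; apply: (@adj_by _ _ v v w); first by rewrite (negPf nP) qvw.
by move=> s t sv tv; rewrite qP.
Qed.

(* The three moves that pull one vertex out of a part abc have the apex a|b|c, so they would be a
   triangle, but a move of a to another part is adjacent to exactly one of them. *)
Lemma triple_no_leave a b c q w :
  uniq [:: a; b; c] -> class a [:: a; b; c] -> moves q a w -> False.
Proof.
rewrite /= !inE !negb_or -!andbA => /and4P[ab ac bc _] cl mq.
have [ba ca cb] : [/\ b != a, c != a & c != b] by split; rewrite eq_sym.
have aw := moves_neq mq; have [Paw qaw qP] := mq.
have [wb wc] : w != b /\ w != c.
  by move: Paw; rewrite cl !inE !negb_or => /and3P[].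
have Pab : tog P a b by rewrite cl !inE eqxx orbT.
have Pac : tog P a c by rewrite cl !inE eqxx !orbT.
have Pbc : tog P b c by rewrite (tog_trans _ Pac) // tog_sym.
have [qa qaE] := refine_ex P (fun s => s == a).
have [qb qbE] := refine_ex P (fun s => s == b).
have [qc qcE] := refine_ex P (fun s => s == c).
have [r rE] := refine_ex P (fun s => (s == a, s == b, s == c)).
have E := (Pab, Pac, Pbc, eqxx, negPf ab, negPf ac, negPf bc, negPf ba, negPf ca, negPf cb).
have mem3 s t : tog P s t -> [|| s == a, s == b | s == c] = [|| t == a, t == b | t == c].
  by move=> st; have := class_mem cl st; rewrite !inE.
have Pqa : adj P qa.
  apply: (@adj_by _ _ a a b); first by rewrite qaE !E.
  by move=> s t sa ta; rewrite qaE (negPf sa) (negPf ta) andbT.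
have Pqb : adj P qb.
  apply: (@adj_by _ _ b a b); first by rewrite qbE !E.
  by move=> s t sb tb; rewrite qbE (negPf sb) (negPf tb) andbT.
have Pqc : adj P qc.
  apply: (@adj_by _ _ c a c); first by rewrite qcE !E.
  by move=> s t sb tb; rewrite qcE (negPf sb) (negPf tb) andbT.
have qab : adj qa qb.
  apply: (@adj_by _ _ c a c); first by rewrite qaE qbE !E.
  move=> s t sc tc; rewrite qaE qbE; case st: (tog P s t) => //=.
  have := mem3 s t st; rewrite (negPf sc) (negPf tc) ?orbF ?andbT /=.
  have := eq_both s ab; have := eq_both t ab.
  by case: (s == a); case: (t == a); case: (s == b); case: (t == b).
have qac : adj qa qc.
  apply: (@adj_by _ _ b a b); first by rewrite qaE qcE !E.
  move=> s t sb tb; rewrite qaE qcE; case st: (tog P s t) => //=.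
  have := mem3 s t st; rewrite (negPf sb) (negPf tb) ?orbF ?andbT /=.
  have := eq_both s ac; have := eq_both t ac.
  by case: (s == a); case: (t == a); case: (s == c); case: (t == c).
have qbc : adj qb qc.
  apply: (@adj_by _ _ a a b); first by rewrite qbE qcE !E.
  move=> s t sa ta; rewrite qbE qcE; case st: (tog P s t) => //=.
  have := mem3 s t st; rewrite (negPf sa) (negPf ta) ?orbF ?andbT /=.
  have := eq_both s bc; have := eq_both t bc.
  by case: (s == b); case: (t == b); case: (s == c); case: (t == c).
have rqa : adj r qa.
  apply: (@adj_by _ _ b b c); first by rewrite rE qaE !xpair_eqE !E.
  move=> s t sb tb; rewrite rE qaE !xpair_eqE; case st: (tog P s t) => //=.
  have := mem3 s t st; rewrite (negPf sb) (negPf tb) ?orbF ?andbT /=.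
  have := eq_both s ac; have := eq_both t ac.
  by case: (s == a); case: (t == a); case: (s == c); case: (t == c).
have rqb : adj r qb.
  apply: (@adj_by _ _ a a c); first by rewrite rE qbE !xpair_eqE !E.
  move=> s t sa ta; rewrite rE qbE !xpair_eqE; case st: (tog P s t) => //=.
  have := mem3 s t st; rewrite (negPf sa) (negPf ta) ?orbF ?andbT /=.
  have := eq_both s bc; have := eq_both t bc.
  by case: (s == b); case: (t == b); case: (s == c); case: (t == c).
have rqc : adj r qc.
  apply: (@adj_by _ _ b a b); first by rewrite rE qcE !xpair_eqE !E.
  move=> s t sb tb; rewrite rE qcE !xpair_eqE; case st: (tog P s t) => //=.
  have := mem3 s t st; rewrite (negPf sb) (negPf tb) ?orbF ?andbT /=.
  have := eq_both s ac; have := eq_both t ac.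
  by case: (s == a); case: (t == a); case: (s == c); case: (t == c).
have fr : far P r.
  apply: (near_far a); apply: (@not_near_triangle _ _ a b c) => //;
  by rewrite rE !xpair_eqE !E.
have qqa : adj q qa.
  apply: (@adj_by _ _ a a w); first by rewrite qaE (negPf Paw) qaw.
  by move=> s t sa ta; rewrite qP // qaE (negPf sa) (negPf ta) andbT.
have qac_ : tog q a c = false.
  rewrite (movesE mq) //; apply/negP=> Pwc; case/negP: Paw.
  by rewrite (tog_trans Pac) // tog_sym.
have qab_ : tog q a b = false.
  rewrite (movesE mq) //; apply/negP=> Pwb; case/negP: Paw.
  by rewrite (tog_trans Pab) // tog_sym.
have [bw cw] : b != w /\ c != w by split; rewrite eq_sym.
have nqb : ~ near q qb.
  apply: (@not_near_disjoint _ _ a w b c) => //; last by rewrite qP // qbE !E.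
  by rewrite qaw qbE (negPf Paw).
have nqc : ~ near q qc.
  apply: (@not_near_disjoint _ _ a w b c) => //; last by rewrite qP // qcE !E.
  by rewrite qaw qcE (negPf Paw).
case: (triangle_touch rootP Pqa Pqb Pqc (moves_adj mq) qab qac qbc fr rqa rqb rqc qqa).
- by move=> qq; apply: nqb; rewrite qq; exists a.
- by move=> qq; apply: nqc; rewrite qq; exists a.
- by move=> /adjE[].
- by move=> /adjE[].
Qed.

(* Apply prism to the move of x into abc and to pulling out a or b: the far vertices a|bcx and b|acx
   are not adjacent. *)
Lemma triple_no_enter a b c q (x : G) :
  uniq [:: a; b; c] -> class a [:: a; b; c] -> moves q x a -> False.
Proof.
rewrite /= !inE !negb_or -!andbA => /and4P[ab ac bc _] cl mq.
have [ba ca cb] : [/\ b != a, c != a & c != b] by split; rewrite eq_sym.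
have xa := moves_neq mq; have [Pxa qxa qP] := mq.
have [xb xc] : x != b /\ x != c.
  by move: Pxa; rewrite tog_sym cl !inE !negb_or => /and3P[].
have [ax bx cx] : [/\ a != x, b != x & c != x] by split; rewrite eq_sym.
have Pab : tog P a b by rewrite cl !inE eqxx orbT.
have Pac : tog P a c by rewrite cl !inE eqxx !orbT.
have Pbc : tog P b c by rewrite (tog_trans _ Pac) // tog_sym.
have Pxb : tog P x b = false.
  by rewrite tog_sym; apply/negP=> bxP; case/negP: Pxa; rewrite tog_sym (tog_trans Pab).
have qab : tog q a b by rewrite qP.
have qac : tog q a c by rewrite qP.
have qbc : tog q b c by rewrite qP.
have qxb : tog q x b by rewrite (tog_trans qxa).
have E := (Pab, Pac, Pbc, Pxb, negPf Pxa, qab, qac, qbc, qxb, qxa, eqxx, negPf ab, negPf ac,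
  negPf bc, negPf ba, negPf ca, negPf cb, negPf xa, negPf xb, negPf xc, negPf ax, negPf bx,
  negPf cx).
have mem3 s t : tog P s t -> [|| s == a, s == b | s == c] = [|| t == a, t == b | t == c].
  by move=> st; have := class_mem cl st; rewrite !inE.
have [qa qaE] := refine_ex P (fun s => s == a).
have [qb qbE] := refine_ex P (fun s => s == b).
have [r rE] := refine_ex q (fun s => s == a).
have [r' r'E] := refine_ex q (fun s => s == b).
have Pqa : adj P qa.
  apply: (@adj_by _ _ a a b); first by rewrite qaE !E.
  by move=> s t sa ta; rewrite qaE (negPf sa) (negPf ta) andbT.
have Pqb : adj P qb.
  apply: (@adj_by _ _ b a b); first by rewrite qbE !E.
  by move=> s t sb tb; rewrite qbE (negPf sb) (negPf tb) andbT.
have qab' : adj qa qb.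
  apply: (@adj_by _ _ c a c); first by rewrite qaE qbE !E.
  move=> s t sc tc; rewrite qaE qbE; case st: (tog P s t) => //=.
  have := mem3 s t st; rewrite (negPf sc) (negPf tc) ?orbF ?andbT /=.
  have := eq_both s ab; have := eq_both t ab.
  by case: (s == a); case: (t == a); case: (s == b); case: (t == b).
have nqa : ~ near q qa.
  by apply: (@not_near_triangle _ _ x a b); rewrite // qaE !E.
have nqb : ~ near q qb.
  by apply: (@not_near_triangle _ _ x a b); rewrite // qbE !E.
have rq : adj r q.
  apply: (@adj_by _ _ a a b); first by rewrite rE !E.
  by move=> s t sa ta; rewrite rE (negPf sa) (negPf ta) andbT.
have rq' : adj r' q.
  apply: (@adj_by _ _ b a b); first by rewrite r'E !E.
  by move=> s t sa ta; rewrite r'E (negPf sa) (negPf ta) andbT.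
have rqa : adj r qa.
  apply: (@adj_by _ _ x x b); first by rewrite rE qaE !E.
  by move=> s t sx tx; rewrite rE qaE qP.
have rqb : adj r' qb.
  apply: (@adj_by _ _ x x a); first by rewrite r'E qbE !E.
  by move=> s t sx tx; rewrite r'E qbE qP.
have fr : far P r.
  by apply: (near_far a); apply: (@not_near_disjoint _ _ a c x b); rewrite // rE !E.
have fr' : far P r'.
  by apply: (near_far a); apply: (@not_near_disjoint _ _ b c x a); rewrite // r'E !E.
have nrr : ~ near r r'.
  apply: (@not_near_disjoint _ _ a c b x); rewrite // rE r'E ?E //.
  by rewrite (tog_sym q b x) !E.
case: (prism rootP (moves_adj mq) Pqa Pqb qab' (not_near_neq a nqa) (not_near_adj nqa)
  (not_near_neq a nqb) (not_near_adj nqb) fr rq rqa fr' rq' rqb).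
  by move=> rr; apply: nrr; rewrite rr; exists a.
by case/adjE.
Qed.

Lemma class_pair_sym u v : class u [:: u; v] -> class v [:: v; u].
Proof.
move=> cl t; have /eqP uv : tog P u v by rewrite cl !inE eqxx orbT.
by rewrite /tog -uv -/(tog P u t) cl !inE orbC.
Qed.

(** Isolating either end of a two-vertex part has the same effect. *)
Lemma pair_split_sym a b s t : a != b -> class a [:: a; b] -> tog P s t ->
  ((s == a) == (t == a)) = ((s == b) == (t == b)).
Proof.
move=> ab cl st; have := class_mem cl st; rewrite !inE.
have := eq_both s ab; have := eq_both t ab.
by case: (s == a); case: (t == a); case: (s == b); case: (t == b).
Qed.

(* Moving x from its part xy into ab and splitting ab have two far common neighbours, a|bx|y and
   b|ax|y. *)
Lemma pair_no_enter_block a b q (x y : G) : a != b -> class a [:: a; b] ->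
  moves q x a -> x != y -> tog P x y -> False.
Proof.
move=> ab cl mq xy Pxy; have xa := moves_neq mq; have [Pxa qxa qP] := mq.
have Pab : tog P a b by rewrite cl !inE eqxx orbT.
have Pxb : tog P x b = false.
  by apply/negP=> Pxb; case/negP: Pxa; rewrite (tog_trans Pxb) // tog_sym.
have Pay : tog P a y = false.
  by apply/negP=> Pay; case/negP: Pxa; rewrite (tog_trans Pxy) // tog_sym.
have xb : x != b by apply: contraFneq Pxb => <-; apply: tog_refl.
have ay : a != y by apply: contraFneq Pay => <-; apply: tog_refl.
have yb : y != b by apply: contraFneq Pay => ->.
have [ax bx by_] : [/\ a != x, b != x & b != y] by split; rewrite eq_sym.
have ba : b != a by rewrite eq_sym.
have qab : tog q a b by rewrite qP.
have qxb : tog q x b by rewrite (tog_trans qxa).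
have qxy : tog q x y = false by rewrite (movesE mq) // eq_sym.
have E := (Pab, Pxb, Pxy, negPf Pxa, qab, qxb, qxa, qxy, eqxx, negPf ab, negPf ba,
  negPf xa, negPf xb, negPf ax, negPf bx).
have [qa qaE] := refine_ex P (fun s => s == a).
have [r rE] := refine_ex q (fun s => s == a).
have [r' r'E] := refine_ex q (fun s => s == b).
have Pqa : adj P qa.
  apply: (@adj_by _ _ a a b); first by rewrite qaE !E.
  by move=> s t sa ta; rewrite qaE (negPf sa) (negPf ta) andbT.
have nqa : ~ near qa q.
  by apply: (@not_near_triangle _ _ x a b); rewrite // qaE !E.
have rq : adj r q.
  apply: (@adj_by _ _ a a b); first by rewrite rE !E.
  by move=> s t sa ta; rewrite rE (negPf sa) (negPf ta) andbT.
have rq' : adj r' q.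
  apply: (@adj_by _ _ b a b); first by rewrite r'E !E.
  by move=> s t sa ta; rewrite r'E (negPf sa) (negPf ta) andbT.
have rqa : adj r qa.
  apply: (@adj_by _ _ x x b); first by rewrite rE qaE !E.
  by move=> s t sx tx; rewrite rE qaE qP.
have rqa' : adj r' qa.
  apply: (@adj_by _ _ x x a); first by rewrite r'E qaE !E.
  move=> s t sx tx; rewrite r'E qaE qP //; case st: (tog P s t) => //=.
  by rewrite (pair_split_sym ab cl st).
have fr : far P r.
  by apply: (near_far a); apply: (@not_near_disjoint _ _ a b x y); rewrite // rE !E.
have fr' : far P r'.
  by apply: (near_far a); apply: (@not_near_disjoint _ _ a b x y); rewrite // r'E !E.
have rr' := square_uniq rootP Pqa (moves_adj mq) (not_near_neq a nqa)
  (not_near_adj nqa) fr rqa rq fr' rqa' rq'.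
by have := rE x b; rewrite rr' r'E !E.
Qed.

(* Here the common neighbours of a|b|x and abx are ab|x, ax|b and bx|a, none of which is far from P, so
   square_ex fails. *)
Lemma pair_no_enter_single a b q (x : G) : a != b -> class a [:: a; b] ->
  moves q x a -> class x [:: x] -> False.
Proof.
move=> ab cl mq clx; have xa := moves_neq mq; have [Pxa qxa qP] := mq.
have Pxt t : tog P x t = (t == x) by rewrite clx inE.
have Pab : tog P a b by rewrite cl !inE eqxx orbT.
have Pxb : tog P x b = false.
  by apply/negP=> Pxb; case/negP: Pxa; rewrite (tog_trans Pxb) // tog_sym.
have xb : x != b by apply: contraFneq Pxb => <-; apply: tog_refl.
have [ax bx] : a != x /\ b != x by split; rewrite eq_sym.
have ba : b != a by rewrite eq_sym.
have qab : tog q a b by rewrite qP.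
have qxb : tog q x b by rewrite (tog_trans qxa).
have E := (Pab, Pxb, negPf Pxa, qab, qxb, qxa, eqxx, negPf ab, negPf ba,
  negPf xa, negPf xb, negPf ax, negPf bx).
have [p pE] := refine_ex P (fun s => s == a).
have Pp : adj P p.
  apply: (@adj_by _ _ a a b); first by rewrite pE !E.
  by move=> s t sa ta; rewrite pE (negPf sa) (negPf ta) andbT.
have npq : ~ near p q.
  by apply: (@not_near_triangle _ _ x a b); rewrite // pE !E.
have [r [/far_near nPr /adjE[_ [z rp]] /adjE[_ [w rq]]]] :=
  square_ex rootP Pp (moves_adj mq) (not_near_neq a npq) (not_near_adj npq).
have clb := class_pair_sym cl.
have pE' s t : tog p s t = tog P s t && ((s == b) == (t == b)).
  rewrite pE; case st: (tog P s t) => //=; exact: (pair_split_sym ab cl st).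
(* A change from [q] at [x] would absorb the move of [x], and a change from [p] at [a] or [b] would
   absorb the split; in each case [r] would be near [P]. *)
have wx : w != x.
  by apply: contra_notN nPr => /eqP wx; exists x => s t sx tx; rewrite rq ?qP ?wx.
have za : z != a.
  apply: contra_notN nPr => /eqP za; exists a => s t sa ta.
  by rewrite rp ?za // pE (negPf sa) (negPf ta) andbT.
have zb : z != b.
  apply: contra_notN nPr => /eqP zb; exists b => s t sb tb.
  by rewrite rp ?zb // pE' (negPf sb) (negPf tb) andbT.
(* Here [c] is the end of [ab] at which [r] differs from [q], and [d] is the other end. Then [x]
   stays with [d] in [r], which forces [z = x]; so [r] isolates [c] and arises from [P] by moving
   [d] to [x]. *)
have key c d : c != d -> class c [:: c; d] -> x != c -> x != d ->
    tog q x d -> tog q x =1 (fun t => (t == x) || tog P c t) ->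
    (forall s t, tog p s t = tog P s t && ((s == c) == (t == c))) ->
    z != c -> z != d -> w = c -> False.
  move=> cd clc xc xd qxd qx pEc zc zd wc; subst w; apply: nPr.
  have dc : d != c by rewrite eq_sym.
  have rxd : tog r x d by rewrite rq.
  have zx : z = x.
    apply: contraTeq rxd => zx; rewrite rp 1?eq_sym // pEc Pxt eq_sym (negPf xd).
    by [].
  subst z; have rcd : tog r c d = false.
    by rewrite rp // 1?eq_sym // pEc eqxx (negPf dc) andbF.
  have rct t : t != d -> tog r c t = (t == c).
    move=> td; have [->|tc] := eqVneq t c; first exact: tog_refl.
    have [->|tx] := eqVneq t x.
      by apply/negP=> cx; move: rcd; rewrite (tog_trans cx).
    by rewrite rp // 1?eq_sym // pEc clc !inE (negPf td) (negPf tc).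
  have Pct t : t != d -> tog P c t = (t == c).
    by move=> td; rewrite clc !inE (negPf td) orbF.
  have rxt t : t != d -> tog r x t = (t == x).
    move=> td; have [->|tc] := eqVneq t c.
      by rewrite tog_sym rct // eq_sym.
    rewrite rq // qx Pct // (negPf tc) orbF.
    by [].
  exists d => s t sd td.
  have [->|sc] := eqVneq s c; first by rewrite rct // Pct.
  have [->|tc] := eqVneq t c; first by rewrite tog_sym [RHS]tog_sym rct // Pct.
  have [->|sx] := eqVneq s x; first by rewrite rxt // Pxt.
  have [->|tx] := eqVneq t x; first by rewrite tog_sym [RHS]tog_sym rxt // Pxt.
  by rewrite rq // qP.
have qx : tog q x =1 (fun t => (t == x) || tog P a t).
  move=> t; have [->|tx] := eqVneq t x; first exact: tog_refl.
  exact: movesE.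
have qx' : tog q x =1 (fun t => (t == x) || tog P b t).
  by move=> t; rewrite qx clb cl !inE [X in _ || X]orbC.
have [wa|wa] := eqVneq w a; first by apply: (key a b).
have [wb|wb] := eqVneq w b; first by apply: (key b a).
have : tog r a b by rewrite rq // eq_sym.
by rewrite rp 1?eq_sym // pE Pab !E.
Qed.

Lemma pair_no_enter a b q (x : G) : a != b -> class a [:: a; b] -> ~ moves q x a.
Proof.
move=> ab cl mq; have [clx|[y xy clx]|[y [z [u clx]]]] := class_cases x.
- exact: (pair_no_enter_single ab cl mq).
- by apply: (pair_no_enter_block ab cl mq xy); rewrite clx !inE eqxx orbT.
- apply: (@pair_no_enter_block a b q x y ab cl mq); last by rewrite clx !inE eqxx orbT.
  by move: u; rewrite /= !inE !negb_or => /andP[/andP[]].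
Qed.

(* The ways in which a move from P to q is charged to the edge uv: splitting the part uv, pulling a out
   of the part uva (charged to the opposite edge), or joining u, whose part has at most two vertices, to
   the singleton v. *)
Inductive realizes q u v : Prop :=
  | Split of u != v & class u [:: u; v] &
      forall s t, tog q s t = tog P s t && ((s == u) == (t == u))
  | Extract a of uniq [:: u; v; a] & class u [:: u; v; a] &
      forall s t, tog q s t = tog P s t && ((s == a) == (t == a))
  | Join b of moves q u v & class v [:: v] & class u [:: u; b].

Lemma realizes_coadj q u v : realizes q u v -> coadj u v.
Proof.
have nadj x s t : s != t -> tog x s t -> coadj s t.
  by move=> st Pst; rewrite /coadj st (tog_indep Pst).
case=> [uv cl _|a|b mq _ _].
- by apply: (nadj P); rewrite // cl !inE eqxx orbT.
- rewrite /= !inE !negb_or => /andP[/andP[uv _] _] cl _.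
  by apply: (nadj P); rewrite // cl !inE eqxx orbT.
- by apply: (nadj q); [exact: moves_neq mq | case: mq].
Qed.

Lemma moves_eq q q' v w : moves q v w -> moves q' v w -> q = q'.
Proof.
move=> mq mq'; apply: tog_inj => s t.
have key u : tog q v u = tog q' v u.
  have [->|uv] := eqVneq u v; first by rewrite !tog_refl.
  by rewrite (movesE mq) // (movesE mq').
have [->|sv] := eqVneq s v; first exact: key.
have [->|tv] := eqVneq t v; first by rewrite tog_sym key tog_sym.
by have [[_ _ qP] [_ _ q'P]] := (mq, mq'); rewrite qP ?q'P.
Qed.

(** If the changed vertex gains a companion, the exclusions above leave only a join to a singleton.
    If it gains none, it is cut off alone from a part of two or three vertices. *)
Lemma realizes_ex q : adj P q -> exists u v, realizes q u v.
Proof.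
case/adjE=> nPq [v Pq].
have qP s t : s != v -> t != v -> tog q s t = tog P s t by move=> sv tv; rewrite Pq.
have [/existsP[w /andP[qvw Pvw]]|] := boolP [exists w, tog q v w && ~~ tog P v w].
  have mq : moves q v w by [].
  have clw : class w [:: w].
    have [//|[b wb cl]|[b [c [u cl]]]] := class_cases w.
      by case: (pair_no_enter wb cl mq).
    by case: (triple_no_enter u cl mq).
  have [cl|[b vb cl]|[b [c [u cl]]]] := class_cases v.
  (* Naming [v] as its own companion encodes that it is a singleton. *)
  - by exists v, w; apply: (@Join _ _ _ v) => // t; rewrite cl !inE orbb.
  - by exists v, w; apply: (@Join _ _ _ b).
  - by case: (triple_no_leave u cl mq).
rewrite negb_exists => /forallP qsub.
have {}qsub w : tog q v w -> tog P v w.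
  by move=> qvw; have := qsub w; rewrite qvw negbK.
have qE s t : tog q v =1 pred1 v -> tog q s t = tog P s t && ((s == v) == (t == v)).
  move=> qv; have [->|sv] := eqVneq s v.
    by rewrite qv /=; case: eqVneq => [->|]; rewrite ?tog_refl ?andbF.
  have [->|tv] := eqVneq t v; first by rewrite tog_sym qv /= (negPf sv) andbF.
  by rewrite qP // andbT.
(* If [v] kept one companion, it would keep its whole old part, and [q] would equal [P]. *)
have qv : tog q v =1 pred1 v.
  move=> w /=; have [->|wv] := eqVneq w v; first exact: tog_refl.
  apply/negP=> qvw; case/eqP: nPq; apply: tog_inj => s t.
  have key u : tog P v u = tog q v u.
    have [->|uv] := eqVneq u v; first by rewrite !tog_refl.
    apply/idP/idP => [Pvu|/qsub//]; apply: (tog_trans qvw).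
    by rewrite qP // (tog_trans _ Pvu) // tog_sym qsub.
  have [->|sv] := eqVneq s v; first exact: key.
  have [->|tv] := eqVneq t v; first by rewrite tog_sym key tog_sym.
  by rewrite qP.
have [cl|[b vb cl]|[b [c [u cl]]]] := class_cases v.
- case/eqP: nPq; apply: tog_inj => s t; rewrite qE //.
  case st: (tog P s t) => //=; have := class_mem cl st; rewrite !inE => ->.
  by rewrite eqxx.
- by exists v, b; apply: Split => // s t; apply: qE.
exists b, c; apply: (@Extract _ _ _ v) => [|t|s t]; last exact: qE.
  by move: u; rewrite (perm_uniq (_ : perm_eq _ [:: b; c; v])) // -(perm_rcons v [:: b; c]).
rewrite !inE; have : tog P v b by rewrite cl !inE eqxx orbT.
move=> /eqP vb; rewrite /tog -vb -/(tog P v t) cl !inE.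
by case: (t == v); case: (t == b); case: (t == c).
Qed.

Lemma class_triple_sym u v a : class u [:: u; v; a] -> class v [:: v; u; a].
Proof.
move=> cl t; have /eqP uv : tog P u v by rewrite cl !inE eqxx orbT.
by rewrite /tog -uv -/(tog P u t) cl !inE orbCA.
Qed.

Lemma realizes_sym_split q u v : tog P u v -> realizes q u v -> realizes q v u.
Proof.
move=> Puv [uv cl qE|a una cl qE|b [/negP[]]//].
- apply: Split; rewrite 1?eq_sym //; first exact: class_pair_sym.
  move=> s t; rewrite qE; case st: (tog P s t) => //=.
  exact: (pair_split_sym uv cl st).
- apply: (@Extract _ _ _ a) => //; last exact: class_triple_sym.
  move: una; rewrite /= !inE !negb_or [v == u]eq_sym.
  by case/andP=> /andP[-> ->] /andP[-> _].
Qed.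

End Moves.

(** * Charged edges: uniqueness and meeting *)

Section Realization.
Variables (G : sgraph) (k : nat) (P : upper_bell k G).
Hypothesis rootP : rootlike P.
Implicit Types (x y q r : upper_bell k G) (s t u v : G) (e f : {set G}).

(** Even an extraction, which changes [a] and not [u] or [v], is invisible outside the opposite
    edge, because the rest of the part is [a] alone. *)
Lemma realizes_outside q u v s t : realizes P q u v ->
  s \notin [set u; v] -> t \notin [set u; v] -> tog q s t = tog P s t.
Proof.
rewrite !inE !negb_or => rq /andP[su sv] /andP[tu tv]; case: rq => [_ _ qE|a _ cl qE|b mq _ _].
- by rewrite qE (negPf su) (negPf tu) andbT.
- rewrite qE; case st: (tog P s t) => //=.
  have := class_mem cl st; rewrite !inE (negPf su) (negPf sv) (negPf tu) (negPf tv) /=.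
  by move=> ->; rewrite eqxx.
- by case: mq => _ _ qP; rewrite qP.
Qed.

(** An extraction leaves [u] and [v] together, so its trace is the pair of [u] and the extracted
    [a]. *)
Lemma realizes_diff q u v : realizes P q u v -> tog q u v != tog P u v \/
  exists2 a, tog q u a != tog P u a & uniq [:: u; v; a] /\ class P u [:: u; v; a].
Proof.
case=> [uv cl qE|a una cl qE|b [nP qw _] _ _].
- by left; rewrite qE cl !inE !eqxx orbT [v == u]eq_sym (negPf uv).
- right; exists a => //; rewrite qE cl !inE !eqxx !orbT /=.
  move: una; rewrite /= !inE !negb_or => /andP[/andP[_ ua] _].
  by rewrite (negPf ua).
- by left; rewrite (negPf nP) qw.
Qed.

(** A change on [uv] itself rules out an extraction, and both ends of a split or a join lie in parts
    of at most two vertices. *)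
Lemma realizes_notin_triple q u v : realizes P q u v ->
  tog q u v != tog P u v -> forall a b c, uniq [:: a; b; c] -> class P a [:: a; b; c] ->
  (u \notin [:: a; b; c]) /\ (v \notin [:: a; b; c]).
Proof.
move=> rq nq a b c unabc cl.
have sz w d : class P w [:: w; d] -> w \notin [:: a; b; c].
  move=> clw; apply/negP; rewrite -cl => aw.
  have sub : {subset [:: a; b; c] <= [:: w; d]}.
    by move=> t; rewrite -cl -clw; apply: tog_trans; rewrite tog_sym.
  by have := uniq_leq_size unabc sub.
case: rq nq => [uv clu qE|d un clu qE|d mq clv clu].
- by split; [apply: (sz u v) | apply: (sz v u); apply: class_pair_sym].
- rewrite qE; have [ud vd] : u != d /\ v != d.
    by move: un; rewrite /= !inE !negb_or => /andP[/andP[_ ->] /andP[->]].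
  by rewrite (negPf ud) (negPf vd) eqxx andbT eqxx.
- split; first exact: (sz u d).
  by apply: (sz v v) => t; rewrite clv !inE orbb.
Qed.

(** Disjoint edges would give two disjoint pairs on which [q] and [q'] disagree, against adjacency.
    An extraction contributes the pair [ua], so most of the work is to keep [a] away from the other
    pair. *)
Lemma realizes_meet q q' u v u' v' : realizes P q u v -> realizes P q' u' v' ->
  adj q q' -> meets [set u; v] [set u'; v'].
Proof.
move=> rq rq' /adjE[_ nqq']; apply: contraT => nm; exfalso.
have nm' : ~~ meets [set u'; v'] [set u; v] by rewrite meets_sym.
have o s t : s \in [set u; v] -> t \in [set u; v] -> tog q' s t = tog P s t.
  by move=> si ti; apply: (realizes_outside rq'); apply: (meetsN nm).
have o' s t : s \in [set u'; v'] -> t \in [set u'; v'] -> tog q s t = tog P s t.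
  by move=> si ti; apply: (realizes_outside rq); apply: (meetsN nm').
have [uI vI] : u \in [set u; v] /\ v \in [set u; v] by rewrite !inE !eqxx orbT.
have [uI' vI'] : u' \in [set u'; v'] /\ v' \in [set u'; v'] by rewrite !inE !eqxx orbT.
have [uu' uv'] : u != u' /\ u != v'.
  by have := meetsN nm uI; rewrite !inE !negb_or => /andP[].
have [vu' vv'] : v != u' /\ v != v'.
  by have := meetsN nm vI; rewrite !inE !negb_or => /andP[].
have third q1 u1 v1 a : realizes P q1 u1 v1 -> u1 != a -> v1 != a -> forall s,
    s != u1 -> s != v1 -> tog q1 s a = tog P s a.
  move=> r1 ua va s su sv; apply: (realizes_outside r1); rewrite !inE negb_or ?su //.
  by rewrite ![a == _]eq_sym ua.
have [d|[a d [un cl]]] := realizes_diff rq; have [d'|[a' d' [un' cl']]] := realizes_diff rq'.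
- apply: (not_near_disjoint (x := q) (y := q') (a := u) (b := v) (c := u') (d := v')) nqq' => //.
    by rewrite o.
  by rewrite o' // eq_sym.
- have [un1 vn1] := realizes_notin_triple rq d un' cl'.
  move: un1 vn1; rewrite !inE !negb_or => /and3P[_ _ ua'] /and3P[_ _ va'].
  apply: (not_near_disjoint (x := q) (y := q') (a := u) (b := v) (c := u') (d := a')) nqq' => //.
    by rewrite o.
  by rewrite (third _ _ _ _ rq) // 1?eq_sym // eq_sym.
- have [un1 vn1] := realizes_notin_triple rq' d' un cl.
  move: un1 vn1; rewrite !inE !negb_or => /and3P[_ _ ua'] /and3P[_ _ va'].
  apply: (not_near_disjoint (x := q) (y := q') (a := u) (b := a) (c := u') (d := v')) nqq' => //.
  + by rewrite (third _ _ _ _ rq').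
  + by rewrite o' // eq_sym.
  + by rewrite eq_sym.
  + by rewrite eq_sym.
move: (un) (un'); rewrite /= !inE !negb_or -!andbA => /and4P[uv ua va _] /and4P[uv1 ua1 va1 _].
(* Two extractions with disjoint edges come from different parts, since three vertices carry no two
   disjoint edges. *)
have disj t : tog P u t -> ~~ tog P u' t.
  move=> ut; apply/negP=> ut'; have uu1 : tog P u u' by rewrite (tog_trans ut) // tog_sym.
  have : tog P u v' by rewrite (tog_trans uu1) // cl' !inE eqxx orbT.
  move: uu1; rewrite !cl !inE ![_ == u]eq_sym ![_ == v]eq_sym (negPf uu') (negPf uv').
  rewrite (negPf vu') (negPf vv') /= => /eqP u'a /eqP v'a.
  by rewrite u'a v'a eqxx in uv1.
have [Pu Pu'] : tog P u a /\ tog P u' a' by rewrite cl cl' !inE !eqxx !orbT.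
have au' : a != u' by apply: contraTneq (disj a Pu) => ->; rewrite negbK tog_refl.
have aa' : a != a' by apply: contraTneq (disj a Pu) => ->; rewrite negbK.
have av' : a != v'.
  by apply: contraTneq (disj a Pu) => ->; rewrite negbK cl' !inE eqxx orbT.
have ua' : u != a'.
  by apply: contraTneq (disj u (tog_refl _ _)) => ->; rewrite negbK.
have va' : v != a'.
  have Pv : tog P u v by rewrite cl !inE eqxx orbT.
  by apply: contraTneq (disj v Pv) => ->; rewrite negbK.
apply: (not_near_disjoint (x := q) (y := q') (a := u) (b := a) (c := u') (d := a')) nqq' => //.
  by rewrite (third _ _ _ _ rq') // eq_sym.
by rewrite (third _ _ _ _ rq) // 1?eq_sym // eq_sym.
Qed.

Lemma moves_flip q u v : class P u [:: u] -> class P v [:: v] ->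
  moves P q v u -> moves P q u v.
Proof.
move=> clu clv mq; have [nP qvu qP] := mq; split; rewrite 1?tog_sym //.
move=> s t su tu; have key w : w != u -> tog q v w = tog P v w.
  move=> wu; have [->|wv] := eqVneq w v; first by rewrite !tog_refl.
  by rewrite (movesE mq) // clu clv !inE (negPf wu) (negPf wv).
have [->|sv] := eqVneq s v; first exact: key.
have [->|tv] := eqVneq t v; first by rewrite tog_sym key // tog_sym.
exact: qP.
Qed.

Lemma realizes_inj_dir q q' u v : realizes P q u v -> realizes P q' u v -> q = q'.
Proof.
case=> [uv cl qE|a un cl qE|b mq clv clu]; case=> [uv' cl' qE'|a' un' cl' qE'|b' mq' clv' clu'].
- by apply: tog_inj => s t; rewrite qE qE'.
- move: un'; rewrite /= !inE !negb_or -!andbA => /and4P[_ ua va _].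
  have : tog P u a' by rewrite cl' !inE eqxx !orbT.
  by rewrite cl !inE ![a' == _]eq_sym (negPf ua) (negPf va).
- by case: mq' => /negP[]; rewrite cl !inE eqxx orbT.
- move: un; rewrite /= !inE !negb_or -!andbA => /and4P[_ ua va _].
  have : tog P u a by rewrite cl !inE eqxx !orbT.
  by rewrite cl' !inE ![a == _]eq_sym (negPf ua) (negPf va).
- move: un; rewrite /= !inE !negb_or -!andbA => /and4P[_ ua va _].
  have : tog P u a by rewrite cl !inE eqxx !orbT.
  rewrite cl' !inE ![a == _]eq_sym (negPf ua) (negPf va) /= => /eqP a'a.
  by apply: tog_inj => s t; rewrite qE qE' a'a.
- by case: mq' => /negP[]; rewrite cl !inE eqxx orbT.
- by case: mq => /negP[]; rewrite cl' !inE eqxx orbT.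
- by case: mq => /negP[]; rewrite cl' !inE eqxx orbT.
- exact: moves_eq mq mq'.
Qed.

Lemma realizes_sym_join q u v : class P u [:: u] -> class P v [:: v] ->
  realizes P q v u -> realizes P q u v.
Proof.
move=> clu clv [vu cl _|a una cl _|b mq _ _].
- have : tog P v u by rewrite cl !inE eqxx orbT.
  by rewrite clv inE eq_sym (negPf vu).
- have : tog P v u by rewrite cl !inE eqxx orbT.
  by rewrite clv inE => /eqP vu; move: una; rewrite vu /= inE eqxx.
- apply: (@Join _ _ _ _ _ _ u) => //; first exact: moves_flip.
  by move=> t; rewrite clu !inE orbb.
Qed.

(** Given the edge, [P] tells the kind of move: the edge lies inside a part of two vertices, inside
    one of three, or across parts. A join in either direction is possible only between singletons,
    and then both directions give the same partition. *)
Lemma realizes_inj q q' u v u' v' : [set u; v] = [set u'; v'] ->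
  realizes P q u v -> realizes P q' u' v' -> q = q'.
Proof.
move=> eqe rq rq'; have /andP[uv _] := realizes_coadj rq.
have : u \in [set u'; v'] by rewrite -eqe !inE eqxx.
have : v \in [set u'; v'] by rewrite -eqe !inE eqxx orbT.
rewrite !inE => /orP[]/eqP vE /orP[]/eqP uE; subst; rewrite ?eqxx // in uv.
  have [Puv|Puv] := boolP (tog P u' v').
    by apply: realizes_inj_dir rq (realizes_sym_split Puv rq').
  have [_ cl|? _ cl|b _ clu' _] := rq'; try by rewrite cl !inE eqxx orbT in Puv.
  have [_ cl|? _ cl|b' _ clv' _] := rq; try by rewrite tog_sym cl !inE eqxx orbT in Puv.
  by apply: (realizes_inj_dir rq); apply: realizes_sym_join.
exact: realizes_inj_dir rq rq'.
Qed.

(** The charge as seen from the common end [v] of a star. Requiring [b != s] in the last case leaves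
    the join of two singletons to the first, as a move of [v]. *)
Lemma star_cases q v s : realizes P q v s \/ realizes P q s v ->
  [\/ [/\ moves P q v s, class P s [:: s] & exists b, class P v [:: v; b]],
      [/\ v != s, class P v [:: v; s] &
          forall t u, tog q t u = tog P t u && ((t == v) == (u == v))],
      exists2 a, uniq [:: v; s; a] & class P v [:: v; s; a] |
      exists b, [/\ moves P q s v, class P v [:: v], class P s [:: s; b] & b != s]].
Proof.
case=> [[vs cl qE|a una cl qE|b mq cls clv]|rq].
- by constructor 2.
- by constructor 3; exists a.
- by constructor 1; split=> //; exists b.
case: (rq) => [sv cl qE|a una cl qE|b mq clv cls].
- have Psv : tog P s v by rewrite cl !inE eqxx orbT.
  have [vs clv qvE|a una cla|b [/negP[]]] := realizes_sym_split Psv rq; last by rewrite tog_sym.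
    by constructor 2.
  by constructor 3; exists a.
- have Psv : tog P s v by rewrite cl !inE eqxx orbT.
  have [vs clv qvE|a' una' cla|b [/negP[]]] := realizes_sym_split Psv rq; last by rewrite tog_sym.
    by constructor 2.
  by constructor 3; exists a'.
- have [bs|bs] := eqVneq b s; last by constructor 4; exists b.
  have cls' : class P s [:: s] by move=> t; rewrite cls bs !inE orbb.
  constructor 1; split=> //; first exact: moves_flip.
  by exists v => t; rewrite clv !inE orbb.
Qed.

(** Suppose [r] had [v] and [s1] together. Since [q2] and [q3] separate them and no change is at
    [v], both changes would be at [s1], and [q2] and [q3] would agree on [v] and [s2], which they do
    not. So [r] separates [v] from [s1], and the change from [q1], which joins them, is at [s1]. *)
Lemma star_core q1 q2 q3 r v s1 s2 z1 z2 z3 :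
  moves P q1 v s1 -> class P s1 [:: s1] -> moves P q2 v s2 -> class P s2 [:: s2] ->
  s1 != s2 -> tog q3 v s1 = false -> tog q3 v s2 = false ->
  z1 != v -> z2 != v -> z3 != v ->
  (forall s t, s != z1 -> t != z1 -> tog r s t = tog q1 s t) ->
  (forall s t, s != z2 -> t != z2 -> tog r s t = tog q2 s t) ->
  (forall s t, s != z3 -> t != z3 -> tog r s t = tog q3 s t) ->
  tog r v s1 = false /\ z1 = s1.
Proof.
move=> m1 c1 m2 c2 s12 q31 q32 z1v z2v z3v r1 r2 r3.
have [vs1 vs2] := (moves_neq m1, moves_neq m2).
have [[_ q1v _] [_ q2v _]] := (m1, m2).
have q2s : tog q2 v s1 = false by rewrite (movesE m2) 1?eq_sym // c2 inE (negPf s12).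
have rs1 : tog r v s1 = false.
  apply/negP=> rs1.
  have z2E : z2 = s1.
    by apply: contraTeq rs1 => zs; rewrite r2 ?q2s // eq_sym.
  have z3E : z3 = s1.
    by apply: contraTeq rs1 => zs; rewrite r3 ?q31 // eq_sym.
  have s2s1 : s2 != s1 by rewrite eq_sym.
  by subst z2 z3; have := r2 v s2 vs1 s2s1; rewrite r3 // q32 q2v.
split=> //; apply: contraFeq rs1 => zs; rewrite r1 //; by rewrite eq_sym.
Qed.

End Realization.

(** * Triangles go to triangles *)

Section Stars.
Variables (G : sgraph) (k : nat) (P : upper_bell k G).
Hypothesis rootP : rootlike P.
Implicit Types (x y q r : upper_bell k G) (s t u v : G) (e f : {set G}).

Definition realizesU q u v := realizes P q u v \/ realizes P q v u.

Lemma not_near_path x y a b c d :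
  tog x a b != tog y a b -> tog x a c != tog y a c -> tog x b d != tog y b d ->
  a != b -> a != d -> b != c -> ~ near x y.
Proof.
move=> ab ac bd nab nad nbc [z xy].
have := diff_at xy ab; have := diff_at xy ac; have := diff_at xy bd.
by move=> /orP[]/eqP-> /orP[]/eqP zE /orP[]/eqP zE'; subst;
  rewrite eqxx in nab nad nbc.
Qed.

Lemma far_witness r q v : far P r -> adj r q ->
  (forall s t, s != v -> t != v -> tog q s t = tog P s t) ->
  exists2 z, z != v & forall s t, s != z -> t != z -> tog r s t = tog q s t.
Proof.
move=> /far_near nPr /adjE[_ [z rq]] qP; exists z => //.
apply: contra_notN nPr => /eqP zv; exists v => s t sv tv.
by rewrite rq ?zv // qP.
Qed.

(** By [star_core] the three changes are at [s1], [s2] and [s3]. Any two vertices miss one of these,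
    so [r] agrees with [P] off [v] and is not far. *)
Lemma star_joins q1 q2 q3 r v s1 s2 s3 :
  moves P q1 v s1 -> class P s1 [:: s1] -> moves P q2 v s2 -> class P s2 [:: s2] ->
  moves P q3 v s3 -> class P s3 [:: s3] -> s1 != s2 -> s1 != s3 -> s2 != s3 ->
  far P r -> adj r q1 -> adj r q2 -> adj r q3 -> False.
Proof.
move=> m1 c1 m2 c2 m3 c3 s12 s13 s23 fr rq1 rq2 rq3.
have [[_ q1v q1P] [_ q2v q2P] [_ q3v q3P]] := And3 m1 m2 m3.
have [z1 z1v r1] := far_witness fr rq1 q1P.
have [z2 z2v r2] := far_witness fr rq2 q2P.
have [z3 z3v r3] := far_witness fr rq3 q3P.
have [vs1 vs2 vs3] := And3 (moves_neq m1) (moves_neq m2) (moves_neq m3).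
have far_end q s s' : moves P q v s -> class P s [:: s] -> v != s' -> s' != s ->
    tog q v s' = false.
  by move=> mq cl vs ss; rewrite (movesE mq) 1?eq_sym // cl inE (negPf ss).
have [s21 s31 s32] : [/\ s2 != s1, s3 != s1 & s3 != s2] by split; rewrite eq_sym.
have [_ E1] := star_core m1 c1 m2 c2 s12 (far_end _ _ _ m3 c3 vs1 s13)
  (far_end _ _ _ m3 c3 vs2 s23) z1v z2v z3v r1 r2 r3.
have [_ E2] := star_core m2 c2 m1 c1 s21 (far_end _ _ _ m3 c3 vs2 s23)
  (far_end _ _ _ m3 c3 vs1 s13) z2v z1v z3v r2 r1 r3.
have [_ E3] := star_core m3 c3 m1 c1 s31 (far_end _ _ _ m2 c2 vs3 s32)
  (far_end _ _ _ m2 c2 vs1 s12) z3v z1v z2v r3 r1 r2.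
subst z1 z2 z3; case: (far_near fr); exists v => s t sv tv.
have [a1|] := boolP ((s != s1) && (t != s1)).
  by case/andP: a1 => ? ?; rewrite r1 // q1P.
have [a2|] := boolP ((s != s2) && (t != s2)).
  by case/andP: a2 => ? ? _; rewrite r2 // q2P.
have [a3|] := boolP ((s != s3) && (t != s3)).
  by case/andP: a3 => ? ? _ _; rewrite r3 // q3P.
rewrite !negb_and !negbK => /orP[]/eqP-> /orP[]/eqP zE /orP[]/eqP zE'; subst;
  by rewrite ?eqxx in s12 s13 s23 s21 s31 s32.
Qed.

(* Needed in star_split: if P has parts vv', s1, s2 and s1s2 is an edge, then splitting vv' and moving v
   to s1 or to s2 have the apex v|v'|s1s2, and this is excluded only by the move that joins s1 and s2,
   which would be missing if P had exactly k parts. *)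
Hypothesis surj : forall u v, coadj u v -> exists2 q, adj P q & realizesU q u v.

Lemma star_split q1 q2 q3 r v s1 s2 s3 :
  moves P q1 v s1 -> class P s1 [:: s1] -> moves P q2 v s2 -> class P s2 [:: s2] ->
  v != s3 -> class P v [:: v; s3] ->
  (forall s t, tog q3 s t = tog P s t && ((s == v) == (t == v))) ->
  realizesU q3 v s3 ->
  s1 != s2 -> adj P q1 -> adj P q3 -> adj q1 q3 ->
  far P r -> adj r q1 -> adj r q2 -> adj r q3 -> False.
Proof.
move=> m1 c1 m2 c2 vs3 cv q3E rq3 s12 Pq1 Pq3 q13 fr rq1 rq2 rq3'.
have [[nP1 q1v q1P] [nP2 q2v q2P]] := (m1, m2).
have q3P s t : s != v -> t != v -> tog q3 s t = tog P s t.
  by move=> sv tv; rewrite q3E (negPf sv) (negPf tv) andbT.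
have [z1 z1v r1] := far_witness fr rq1 q1P.
have [z2 z2v r2] := far_witness fr rq2 q2P.
have [z3 z3v r3] := far_witness fr rq3' q3P.
have [vs1 vs2] := (moves_neq m1, moves_neq m2).
have [s1v s2v s21] : [/\ s1 != v, s2 != v & s2 != s1] by split; rewrite eq_sym.
have q3v s : s != v -> tog q3 v s = false.
  by move=> sv; rewrite q3E eqxx (negPf sv) andbF.
have [_ E1] := star_core m1 c1 m2 c2 s12 (q3v _ s1v) (q3v _ s2v) z1v z2v z3v r1 r2 r3.
have [_ E2] := star_core m2 c2 m1 c1 s21 (q3v _ s2v) (q3v _ s1v) z2v z1v z3v r2 r1 r3.
subst z1 z2.
have s31 : s3 != s1.
  by apply: contraNneq nP1 => <-; rewrite cv !inE eqxx orbT.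
have s32 : s3 != s2.
  by apply: contraNneq nP2 => <-; rewrite cv !inE eqxx orbT.
(* Off [v], agreement with [q1] or [q2] covers every pair except [s1] with [s2]; were these apart as
   well, [r] would be near [P]. *)
have rs12 : tog r s1 s2.
  apply: contraT => nr; case: (far_near fr); exists v => s t sv tv.
  have P12 : tog P s1 s2 = false by rewrite c1 inE (negPf s21).
  have [/andP[? ?]|] := boolP ((s != s1) && (t != s1)); first by rewrite r1 // q1P.
  have [/andP[? ?] _|] := boolP ((s != s2) && (t != s2)); first by rewrite r2 // q2P.
  rewrite !negb_and !negbK => /orP[]/eqP-> /orP[]/eqP zE; subst;
    rewrite ?eqxx ?tog_refl // in s12 s21 *.
    by rewrite tog_sym [RHS]tog_sym P12 (negPf nr).
  by rewrite P12 (negPf nr).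
have cad : coadj s1 s2 by rewrite /coadj s12 (tog_indep rs12).
have [q4 Pq4 rU4] := surj cad.
have rq4 : realizes P q4 s1 s2 by case: rU4 => // /(realizes_sym_join c1 c2).
have m4 : moves P q4 s1 s2.
  case: rq4 => // [_ cl|a _ cl]; have : tog P s1 s2 by rewrite cl !inE eqxx orbT.
    by rewrite c1 inE (negPf s21).
  by rewrite c1 inE (negPf s21).
have [_ q4s q4P] := m4.
have q4v : tog q4 v s3.
  by rewrite q4P // 1?cv ?inE ?eqxx ?orbT //.
have rv : tog r v s3 = false by rewrite r1 // (movesE m1) 1?eq_sym // c1 inE (negPf s31).
have key t : t != v -> tog r s1 t = tog q4 s1 t.
  move=> tv; have [->|t1] := eqVneq t s1; first by rewrite !tog_refl.
  have [->|t2] := eqVneq t s2; first by rewrite q4s rs12.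
  by rewrite r2 // q2P // (movesE m4) // c1 c2 !inE (negPf t1) (negPf t2).
have rq4' : adj r q4.
  apply: (@adj_by _ _ _ _ v v s3); first by rewrite rv q4v.
  move=> s t sv tv.
  have [->|ns1] := eqVneq s s1; first exact: key.
  have [->|nt1] := eqVneq t s1; first by rewrite tog_sym key // tog_sym.
  by rewrite r1 // q1P // q4P.
have q31 : adj q3 q1 by rewrite adj_sym.
(* By [apex_adj], [q4] is [q3] or adjacent to it. The first fails because [q4] keeps [v] with [s3],
   the second because the edges [s1s2] and [vs3] are disjoint. *)
case: (apex_adj rootP Pq3 Pq1 Pq4 q31 fr rq3' rq1 rq4').
  by move=> q43; move: q4v; rewrite q43 q3v // eq_sym.
move=> q43.
have : meets [set s1; s2] [set v; s3].
  case: rq3 => rq3; first exact: (realizes_meet rq4 rq3 q43).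
  by rewrite [[set v; _]]setUC; apply: (realizes_meet rq4 rq3 q43).
case/meetsP=> w; rewrite !inE => /orP[]/eqP-> /orP[]/eqP wE; subst;
  by rewrite ?eqxx in vs1 vs2 s31 s32.
Qed.

(* If s1 comes from a part s1b, the move of s1 to the singleton v is not adjacent to the move charged to
   vs, for s distinct from s1 and b. *)
Lemma star_pull q1 q2 q3 v s1 s2 s3 b :
  realizesU q2 v s2 -> realizesU q3 v s3 ->
  moves P q1 s1 v -> class P v [:: v] -> class P s1 [:: s1; b] -> b != s1 ->
  s1 != s2 -> s1 != s3 -> s2 != s3 -> adj q1 q2 -> adj q1 q3 -> False.
Proof.
have main q s : realizesU q v s -> moves P q1 s1 v -> class P v [:: v] ->
    class P s1 [:: s1; b] -> b != s1 -> s1 != s -> b != s -> ~ near q1 q.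
  move=> rq m1 cv c1 bs1 s1s bs.
  have s1v := moves_neq m1.
  have Ps1b : tog P s1 b by rewrite c1 !inE eqxx orbT.
  have bv : b != v.
    by apply: contraTneq Ps1b => ->; rewrite tog_sym cv inE.
  have Pvs1 : tog P v s1 = false by rewrite cv inE (negPf s1v).
  have vs1 : v != s1 by rewrite eq_sym.
  have [_ q1s q1P] := m1.
  have q1b : tog q1 s1 b = false by rewrite (movesE m1) // cv inE (negPf bv).
  have [vs qvs qvs1 qs1b] : [/\ v != s, tog q v s, tog q v s1 = false & tog q s1 b].
    have nos w : tog P v w -> v != w -> False by rewrite cv inE eq_sym => ->.
    case: (star_cases rq) => [[mq cs _]|[vs cl _]|[a un cl]|[c [mq _ cs cns]]].
    - have [_ qvs qP] := mq; split=> //; first exact: moves_neq mq.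
        by rewrite (movesE mq) // cs inE (negPf s1s).
      by rewrite qP.
    - by case: (nos s) => //; rewrite cl !inE eqxx orbT.
    - case: (nos s); first by rewrite cl !inE eqxx orbT.
      by move: un; rewrite /= !inE !negb_or => /andP[/andP[]].
    - have [_ qsv qP] := mq; have sv := moves_neq mq.
      have [vs ss1] : v != s /\ s1 != s by rewrite eq_sym.
      by split=> //; [rewrite tog_sym | rewrite qP | rewrite qP].
  have Pvs : tog P v s = false by rewrite cv inE eq_sym (negPf vs).
  apply: (@not_near_path _ _ v s1 s b) => //.
  - by rewrite tog_sym q1s qvs1.
  - by rewrite q1P // 1?eq_sym // qvs Pvs.
  - by rewrite q1b qs1b.
  - by rewrite eq_sym.
move=> rq2 rq3 m1 cv c1 bs1 s12 s13 s23 /adjE[_ n12] /adjE[_ n13].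
(* [b] differs from [s2] or from [s3], and [main] applies to that one. *)
have [bs2|bs2] := eqVneq b s2; last exact: (main q2 s2).
by apply: (main q3 s3) => //; rewrite bs2.
Qed.

Lemma star_cases4 q v s : realizesU q v s ->
  [\/ moves P q v s /\ class P s [:: s],
      [/\ v != s, class P v [:: v; s] &
          forall t u, tog q t u = tog P t u && ((t == v) == (u == v))],
      exists2 a, uniq [:: v; s; a] & class P v [:: v; s; a] |
      exists b, [/\ moves P q s v, class P v [:: v], class P s [:: s; b] & b != s]].
Proof.
move/star_cases=> [[mq cs _]|?|?|?]; by [constructor 1|constructor 2|constructor 3|constructor 4].
Qed.

(** The other kinds of charge at [v] require its part to have at most two vertices, so all three
    edges at [v] lie inside the part [vs1a], which has room for only two. *)
Lemma star_no_triple q2 q3 v s1 s2 s3 a :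
  realizesU q2 v s2 -> realizesU q3 v s3 ->
  uniq [:: v; s1; a] -> class P v [:: v; s1; a] ->
  s1 != s2 -> s1 != s3 -> s2 != s3 -> False.
Proof.
move=> rq2 rq3 un cl s12 s13 s23.
have inc q s : realizesU q v s -> s \in [:: v; s1; a] /\ v != s.
  have small w : class P v [:: v; w] -> False.
    move=> cw; have sub : {subset [:: v; s1; a] <= [:: v; w]} by move=> t; rewrite -cl -cw.
    by have := uniq_leq_size un sub.
  move/star_cases=> [[_ _ [b /small]]|[_ /small]|[c un' cl']|[b [_ cv _ _]]] //.
    split; first by rewrite -cl cl' !inE eqxx orbT.
    by move: un'; rewrite /= !inE !negb_or => /andP[/andP[]].
  by case: (small v) => t; rewrite cv !inE orbb.
have [i2 v2] := inc _ _ rq2; have [i3 v3] := inc _ _ rq3.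
move: i2 i3; rewrite !inE ![_ == v]eq_sym ![_ == s1]eq_sym (negPf v2) (negPf v3).
by rewrite (negPf s12) (negPf s13) /= => /eqP s2a /eqP s3a; rewrite s2a s3a eqxx in s23.
Qed.

(** [star_pull] and [star_no_triple] leave only joins of [v] to singletons and splits of the part of
    [v]. At most one is a split, as [v] has only one companion; [star_joins] and [star_split] treat
    the two situations. *)
Lemma no_star_apex q1 q2 q3 r v s1 s2 s3 :
  realizesU q1 v s1 -> realizesU q2 v s2 -> realizesU q3 v s3 ->
  s1 != s2 -> s1 != s3 -> s2 != s3 -> adj P q1 -> adj P q2 -> adj P q3 ->
  adj q1 q2 -> adj q1 q3 -> adj q2 q3 ->
  far P r -> adj r q1 -> adj r q2 -> adj r q3 -> False.
Proof.
move=> R1 R2 R3 s12 s13 s23 P1 P2 P3 q12 q13 q23 fr r1 r2 r3.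
have [s21 s31 s32] : [/\ s2 != s1, s3 != s1 & s3 != s2] by split; rewrite eq_sym.
have [q21 q31 q32] : [/\ adj q2 q1, adj q3 q1 & adj q3 q2] by split; rewrite adj_sym.
have nosplit2 s s' : class P v [:: v; s] -> class P v [:: v; s'] -> v != s -> s = s'.
  move=> cl cl' vs; have : tog P v s by rewrite cl !inE eqxx orbT.
  by rewrite cl' !inE eq_sym (negPf vs) => /eqP.
case: (star_cases4 R1) => [[m1 c1]|[v1 c1 q1E]|[a un cl]|[b [m1 cv c1 b1]]]; last first.
- exact: (star_pull R2 R3 m1 cv c1 b1 s12 s13 s23 q12 q13).
- exact: (star_no_triple R2 R3 un cl s12 s13 s23).
- case: (star_cases4 R2) => [[m2 c2]|[v2 c2 q2E]|[a un cl]|[b [m2 cv c2 b2]]]; last first.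
  + exact: (star_pull R1 R3 m2 cv c2 b2 s21 s23 s13 q21 q23).
  + exact: (star_no_triple R1 R3 un cl s21 s23 s13).
  + by rewrite (nosplit2 _ _ c1 c2 v1) eqxx in s12.
  case: (star_cases4 R3) => [[m3 c3]|[v3 c3 q3E]|[a un cl]|[b [m3 cv c3 b3]]]; last first.
  + exact: (star_pull R1 R2 m3 cv c3 b3 s31 s32 s12 q31 q32).
  + exact: (star_no_triple R1 R2 un cl s31 s32 s12).
  + by rewrite (nosplit2 _ _ c1 c3 v1) eqxx in s13.
  exact: (star_split m2 c2 m3 c3 v1 c1 q1E R1 s23 P2 P1 q21 fr r2 r3 r1).
case: (star_cases4 R2) => [[m2 c2]|[v2 c2 q2E]|[a un cl]|[b [m2 cv c2 b2]]]; last first.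
- exact: (star_pull R1 R3 m2 cv c2 b2 s21 s23 s13 q21 q23).
- exact: (star_no_triple R1 R3 un cl s21 s23 s13).
- case: (star_cases4 R3) => [[m3 c3]|[v3 c3 q3E]|[a un cl]|[b [m3 cv c3 b3]]]; last first.
  + exact: (star_pull R1 R2 m3 cv c3 b3 s31 s32 s12 q31 q32).
  + exact: (star_no_triple R1 R2 un cl s31 s32 s12).
  + by rewrite (nosplit2 _ _ c2 c3 v2) eqxx in s23.
  exact: (star_split m1 c1 m3 c3 v2 c2 q2E R2 s13 P1 P2 q12 fr r1 r3 r2).
case: (star_cases4 R3) => [[m3 c3]|[v3 c3 q3E]|[a un cl]|[b [m3 cv c3 b3]]]; last first.
- exact: (star_pull R1 R2 m3 cv c3 b3 s31 s32 s12 q31 q32).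
- exact: (star_no_triple R1 R2 un cl s31 s32 s12).
- exact: (star_split m1 c1 m2 c2 v3 c3 q3E R3 s12 P1 P3 q13 fr r1 r2 r3).
exact: (star_joins m1 c1 m2 c2 m3 c3 s12 s13 s23 fr r1 r2 r3).
Qed.

End Stars.

(** * Triangles of edges, and the map of edges induced by an isomorphism *)

Definition edge (G : sgraph) := {e : {set G} | is_edge e}.

Definition tri (G : sgraph) (e f g : {set G}) :=
  [&& e != f, e != g, f != g, meets e f, meets e g, meets f g & e :&: f :&: g == set0].

Section Triangles.
Variable G : sgraph.
Implicit Types (e f g : {set G}) (u v w : G).

Lemma triP e f g : is_edge e -> is_edge f -> is_edge g -> tri e f g ->
  exists u v w, [/\ coadj u v, coadj u w & coadj v w] /\
    [/\ e = [set u; v], f = [set u; w] & g = [set v; w]].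
Proof.
move=> ee ef eg /and5P[nef neg nfg /meetsP[u ue uf] /and3P[meg mfg /eqP efg]].
have ug : u \notin g.
  by apply/negP=> ug; have := in_set0 u; rewrite -efg !inE ue uf ug.
have [v uv eE] := edge_at ee ue; have [w uw fE] := edge_at ef uf.
have vg : v \in g.
  by case/meetsP: meg => x; rewrite eE !inE => /orP[]/eqP-> // /negPn; rewrite ug.
have wg : w \in g.
  by case/meetsP: mfg => x; rewrite fE !inE => /orP[]/eqP-> // /negPn; rewrite ug.
have vw : v != w by apply: contraNneq nef => vw; rewrite eE fE vw.
by have [cvw gE] := edge_eq eg vg wg vw; exists u, v, w.
Qed.

(** An edge that meets both [e] and [f] but avoids their common end closes a triangle. Membership in
    a star is thus expressed by relations between edges, which an edge map can transport. *)
Lemma common_vertex e f g v : is_edge e -> is_edge f -> is_edge g ->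
  e != f -> e != g -> f != g -> v \in e -> v \in f ->
  (v \in g) = [&& meets e g, meets f g & ~~ tri e f g].
Proof.
move=> ee ef eg ef' eg' fg' ve vf; have mef : meets e f by apply/meetsP; exists v.
apply/idP/and3P => [vg|[meg mfg]].
  split; try by apply/meetsP; exists v.
  apply/negP=> /and5P[_ _ _ _ /and3P[_ _ /eqP efg]].
  by have := in_set0 v; rewrite -efg !inE ve vf vg.
rewrite /tri ef' eg' fg' mef meg mfg /= => /set0Pn[w]; rewrite !inE -andbA => /and3P[we wf wg].
suff -> : v = w by [].
apply: contraNeq ef' => vw.
by have [_ ->] := edge_eq ee ve we vw; have [_ ->] := edge_eq ef vf wf vw.
Qed.

End Triangles.

(** The triangle clause presupposes surjectivity because [no_star_apex] needs a move charged to
    every edge, and this is known only once the injections in both directions are compared. *)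
Lemma edge_map (G1 G2 : sgraph) (k1 k2 : nat) :
  k1 + 2 <= #|G1| -> isomorphic (upper_bell k1 G1) (upper_bell k2 G2) ->
  exists F : edge G1 -> edge G2,
    [/\ injective F,
        forall e f : edge G1, meets (val e) (val f) -> meets (val (F e)) (val (F f)) &
        (forall e', exists e, F e = e') ->
        forall e f g : edge G1, tri (val e) (val f) (val g) ->
          tri (val (F e)) (val (F f)) (val (F g))].
Proof.
move=> kG [phi phi_bij phiA]; have phi_inj := bij_inj phi_bij.
have [T discT] := discrete_ex kG; pose P := phi T.
have rootP : rootlike P := rootlike_iso phi_bij phiA (rootlike_discrete kG discT).
have /fin_all_exists[X XE] (e : edge G1) : exists x : upper_bell k1 G1, merged x (val e).
  exact: (merged_ex kG (valP e)).
have PX e : adj P (phi (X e)) by rewrite /P phiA; apply: (merged_adj_root discT (valP e) (XE e)).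
have /fin_all_exists[F FE] (e : edge G1) : exists e' : edge G2,
    exists u v, val e' = [set u; v] /\ realizes P (phi (X e)) u v.
  have [u [v r]] := realizes_ex rootP (PX e).
  by exists (Sub _ (edge2 (realizes_coadj r))), u, v.
have X_inj : injective X.
  move=> e f ef; apply: val_inj; apply: (merged_inj (valP e) (valP f) (XE e)).
  by rewrite ef.
have F_inj : injective F.
  move=> e f ef; apply/X_inj/phi_inj.
  have [u [v [uv r]]] := FE e; have [u' [v' [uv' r']]] := FE f.
  by apply: (realizes_inj _ r r'); rewrite -uv -uv' ef.
have XA e f : e != f -> adj (phi (X e)) (phi (X f)) = meets (val e) (val f).
  move=> ef; rewrite phiA (merged_adj (valP e) (valP f) (XE e) (XE f)) //.
  by rewrite (inj_eq X_inj).
have F_meets e f : meets (val e) (val f) -> meets (val (F e)) (val (F f)).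
  have [<- _|ef] := eqVneq e f.
    by have [u ue] := edge_ex (valP (F e)); apply/meetsP; exists u.
  rewrite -XA //; have [u [v [-> r]]] := FE e; have [u' [v' [-> r']]] := FE f.
  exact: realizes_meet r r'.
exists F; split=> // F_surj e f g efg.
have [nef neg nfg] : [/\ e != f, e != g & f != g].
  by move: efg => /and5P[nef neg nfg _ _]; rewrite -!val_eqE.
have [mef meg mfg] : [/\ meets (val e) (val f), meets (val e) (val g) & meets (val f) (val g)].
  by move: efg => /and5P[_ _ _ mef /and3P[meg mfg _]].
rewrite /tri !val_eqE !(inj_eq F_inj) nef neg nfg !F_meets //=.
(* Pairwise meeting images that form no triangle share a vertex [v]: they are a star. *)
apply: contraT => /set0Pn[v]; rewrite !inE -andbA => /and3P[ve vf vg].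
have [s1 _ eE] := edge_at (valP (F e)) ve.
have [s2 _ fE] := edge_at (valP (F f)) vf.
have [s3 _ gE] := edge_at (valP (F g)) vg.
have RU h a b : val (F h) = [set a; b] -> coadj a b -> realizesU P (phi (X h)) a b.
  move=> hE /andP[nab _]; have [u [w [hE' r]]] := FE h.
  have : a \in [set u; w] by rewrite -hE' hE !inE eqxx.
  have : b \in [set u; w] by rewrite -hE' hE !inE eqxx orbT.
  by rewrite !inE => /orP[]/eqP bE /orP[]/eqP aE; subst; rewrite ?eqxx // in nab;
    [right | left].
have cad h s : val (F h) = [set v; s] -> coadj v s.
  move=> hE; have vh : v \in val (F h) by rewrite hE !inE eqxx.
  have [s' vs'] := edge_at (valP (F h)) vh; rewrite hE => ss.
  have [/andP[nvs' _]] := (andP (introT andP (conj vs' vs'))).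
  have : s' \in [set v; s] by rewrite ss !inE eqxx orbT.
  by rewrite !inE eq_sym (negPf nvs') => /eqP<-.
have surj u w : coadj u w -> exists2 q, adj P q & realizesU P q u w.
  move=> uw; have [h hE] := F_surj (Sub _ (edge2 uw)).
  by exists (phi (X h)) => //; apply: RU; rewrite // hE.
have neq h h' s s' : h != h' -> val (F h) = [set v; s] -> val (F h') = [set v; s'] -> s != s'.
  move=> hh hE hE'; apply: contraNneq hh => ss; apply/eqP/F_inj/val_inj.
  by rewrite hE hE' ss.
have [u [a [b [[ua ub ab] [eS fS gS]]]]] := triP (valP e) (valP f) (valP g) efg.
(* The partition [r] merges the triangle of [e], [f] and [g]; its image is the apex that a star
   cannot have. *)
have [r rE] := triangle_vertex kG ua ub ab.
have fr := triangle_far discT ua ub ab rE.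
have rXe : adj r (X e) by apply: (triangle_adj ua ub ab rE); rewrite -eS.
have [au bu ba] : [/\ coadj a u, coadj b u & coadj b a] by split; rewrite coadj_sym.
have rXf : adj r (X f).
  have rE' : [set u; a; b] = [set u; b; a] by rewrite setUAC.
  by apply: (@triangle_adj _ _ u b a); rewrite -?rE' // -fS.
have rXg : adj r (X g).
  have rE' : [set u; a; b] = [set a; b; u] by rewrite -setUA setUC.
  by apply: (@triangle_adj _ _ a b u); rewrite -?rE' // -gS.
case: (no_star_apex rootP surj (RU _ _ _ eE (cad _ _ eE)) (RU _ _ _ fE (cad _ _ fE))
  (RU _ _ _ gE (cad _ _ gE)) (neq _ _ _ _ nef eE fE) (neq _ _ _ _ neg eE gE)
  (neq _ _ _ _ nfg fE gE) (PX e) (PX f) (PX g) (r := phi r)); rewrite ?XA ?phiA //.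
rewrite /far (inj_eq phi_inj) phiA.
exact: fr.
Qed.

(** The injections make the finite sets cut out by [p] and [p'] equally large, so [F] maps the first
    onto the second. *)
Lemma inj_pred_iff (A B : finType) (F : A -> B) (H : B -> A) (p : pred A) (p' : pred B) :
  injective F -> injective H -> (forall x, p x -> p' (F x)) ->
  (forall y, p' y -> p (H y)) -> forall x, p' (F x) -> p x.
Proof.
move=> Finj Hinj Fp Hp x pFx.
have sub : F @: [set x | p x] \subset [set y | p' y].
  by apply/subsetP=> _ /imsetP[z + ->]; rewrite !inE; apply: Fp.
have sub' : H @: [set y | p' y] \subset [set x | p x].
  by apply/subsetP=> _ /imsetP[z + ->]; rewrite !inE; apply: Hp.
have /eqP eqF : F @: [set x | p x] == [set y | p' y].
  rewrite eqEcard sub /= card_imset //.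
  by rewrite -(card_imset _ Hinj) subset_leq_card.
have : F x \in F @: [set x | p x] by rewrite eqF inE.
by rewrite mem_imset // inE.
Qed.

(** Elements of corresponding fibres are matched by their positions in the enumerations. *)
Lemma fibre_bij (A B : finType) (K : eqType) (a : A -> K) (b : B -> K) :
  (forall c, #|[set x | a x == c]| = #|[set y | b y == c]|) ->
  exists2 f : A -> B, bijective f & forall x, b (f x) = a x.
Proof.
have main (A' B' : finType) (a' : A' -> K) (b' : B' -> K) :
    (forall c, #|[set x | a' x == c]| = #|[set y | b' y == c]|) ->
    exists2 f : A' -> B', injective f & forall x, b' (f x) = a' x.
  move=> eqc; have /fin_all_exists[f fE] (x : A') : exists y, b' y = a' x /\
      index y (enum [set y | b' y == a' x]) = index x (enum [set z | a' z == a' x]).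
    have xI : x \in enum [set z | a' z == a' x] by rewrite mem_enum inE.
    have : 0 < #|[set y | b' y == a' x]|.
      by rewrite -eqc; apply/card_gt0P; exists x; rewrite inE.
    case/card_gt0P=> y0 _.
    pose i := index x (enum [set z | a' z == a' x]).
    have iB : i < size (enum [set y | b' y == a' x]).
      by rewrite -cardE -eqc cardE index_mem.
    exists (nth y0 (enum [set y | b' y == a' x]) i); split.
      by have := mem_nth y0 iB; rewrite mem_enum inE => /eqP.
    by rewrite index_uniq ?enum_uniq.
  exists f => [x x' ff|x]; last by case: (fE x).
  have [bx ix] := fE x; have [bx' ix'] := fE x'.
  have aa : a' x = a' x' by rewrite -bx -bx' ff.
  have xI : x \in enum [set z | a' z == a' x'] by rewrite mem_enum inE aa.
  have xI' : x' \in enum [set z | a' z == a' x'] by rewrite mem_enum inE.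
  have ixx : index x (enum [set z | a' z == a' x']) = index x' (enum [set z | a' z == a' x']).
    by rewrite -ix' -ff -aa ix.
  by have := nth_index x xI; rewrite ixx nth_index.
move=> eqc; have [f finj fE] := main _ _ _ _ eqc.
have [g ginj _] := main _ _ _ _ (fun c => esym (eqc c)).
by exists f => //; apply: inj_card_bij => //; apply: leq_card ginj.
Qed.

(** * Recovering the graph from its edges *)

Definition star (G : sgraph) (v : G) : {set edge G} := [set e : edge G | v \in val e].

(* A star determines its centre, except that the two ends of an isolated edge have the same star. Hence
   it is enough to compare the numbers of vertices with a given star. *)
Section StarFibres.
Variables (G1 G2 : sgraph) (F : edge G1 -> edge G2).
Hypothesis F_bij : bijective F.
Hypothesis F_meets : forall e f : edge G1, meets (val (F e)) (val (F f)) = meets (val e) (val f).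
Hypothesis F_tri : forall e f g : edge G1,
  tri (val (F e)) (val (F f)) (val (F g)) = tri (val e) (val f) (val g).
Hypothesis coadj1 : forall v : G1, exists u, coadj v u.

Let F_inj := bij_inj F_bij.

Lemma star_transfer (e f g : edge G1) (v : G1) (w : G2) : e != f -> v \in val e -> v \in val f ->
  w \in val (F e) -> w \in val (F f) -> (w \in val (F g)) = (v \in val g).
Proof.
move=> ef ve vf we wf.
have [<-|eg] := eqVneq e g; first by rewrite we ve.
have [<-|fg] := eqVneq f g; first by rewrite wf vf.
rewrite (common_vertex (valP e) (valP f) (valP g) _ _ _ ve vf) //.
rewrite (common_vertex (valP (F e)) (valP (F f)) (valP (F g)) _ _ _ we wf);
  by rewrite ?F_meets ?F_tri // val_eqE (inj_eq F_inj).
Qed.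

Lemma F_onto e' : exists e, F e = e'.
Proof. by have [H _ HK] := F_bij; exists (H e'). Qed.

(** A vertex on two edges is alone in its fibre; a leaf is alone too, unless its edge is isolated
    and both ends count. [coadj1] excludes isolated vertices, whose common empty star would leave
    their number undetermined. *)
Lemma star_fibre_le c : #|[set v | F @: star v == c]| <= #|[set w | star w == c]|.
Proof.
have [->|/set0Pn[v]] := eqVneq [set v | F @: star v == c] set0; first by rewrite cards0.
rewrite inE => /eqP cE.
have memc e : (F e \in c) = (v \in val e) by rewrite -cE mem_imset // inE.
have fib v' : (v' \in [set v | F @: star v == c]) = (star v' == star v).
  by rewrite inE -cE (inj_eq (imset_inj F_inj)).
have [u vu] := coadj1 v; pose e : edge G1 := Sub _ (edge2 vu).
have ve : v \in val e by rewrite !inE eqxx.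
have ue : u \in val e by rewrite !inE eqxx orbT.
have [/existsP[f /andP[fe vf]]|] := boolP [exists f : edge G1, (f != e) && (v \in val f)].
  have ef : e != f by rewrite eq_sym.
  apply: (@leq_trans 1).
    rewrite -(cards1 v); apply: subset_leq_card; apply/subsetP=> v'; rewrite fib inE => /eqP st.
    have mem (h : edge G1) : v \in val h -> v' \in val h.
      by move=> vh; have : h \in star v'; [rewrite st inE | rewrite inE].
    apply: contraNT ef; rewrite eq_sym => vv; rewrite -val_eqE.
    have [_ ->] := edge_eq (valP e) ve (mem _ ve) vv.
    by have [_ ->] := edge_eq (valP f) vf (mem _ vf) vv.
  (* The common end of the two images has the required star. *)
  have : meets (val (F e)) (val (F f)) by rewrite F_meets; apply/meetsP; exists v.
  case/meetsP=> w we wf; apply/card_gt0P; exists w; rewrite inE; apply/eqP/setP=> g'.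
  have [g <-] := F_onto g'.
  by rewrite memc inE (star_transfer g ef ve vf we wf).
rewrite negb_exists => /forallP leaf.
have {}leaf (f : edge G1) : v \in val f -> f = e.
  by move=> vf; apply/eqP; have := leaf f; rewrite vf andbT negbK.
have [a [b [/andP[nab _] Fe]]] := edgeP _ (valP (F e)).
have aF : a \in val (F e) by rewrite Fe !inE eqxx.
have bF : b \in val (F e) by rewrite Fe !inE eqxx orbT.
have memc' g' : (g' \in c) = (g' == F e).
  have [g <-] := F_onto g'; rewrite memc (inj_eq F_inj).
  by apply/idP/eqP=> [/leaf|->].
have at_u (g : edge G1) x : x \in val (F e) -> x \in val (F g) -> u \in val g.
  move=> xe xg; have : meets (val e) (val g) by rewrite -F_meets; apply/meetsP; exists x.
  case/meetsP=> y; rewrite !inE => /orP[]/eqP-> //.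
  by move/leaf->.
have starc x : x \in val (F e) -> (forall g : edge G1, x \in val (F g) -> g = e) -> star x = c.
  move=> xe xl; apply/setP=> g'; rewrite memc' inE; have [g <-] := F_onto g'.
  by apply/idP/eqP=> [/xl->|->].
(* If [e] is isolated, so is [F e], and both ends of [F e] have star [c]. *)
have [/eqP st|nst] := boolP (star u == star v).
  have isol (g : edge G1) : u \in val g -> g = e.
    by move=> ug; apply: leaf; have : g \in star v; [rewrite -st inE | rewrite inE].
  apply: (@leq_trans #|[set a; b]|).
    apply: (@leq_trans #|[set v; u]|); last by rewrite !cards2 nab; case: (_ != _).
    apply: subset_leq_card; apply/subsetP=> v'; rewrite fib => /eqP st'.
    by have : e \in star v'; [rewrite st' inE | rewrite !inE].
  apply: subset_leq_card; apply/subsetP=> x; rewrite !inE => /orP[]/eqP->.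
    by apply/eqP/starc=> // g /(at_u _ _ aF); apply: isol.
  by apply/eqP/starc=> // g /(at_u _ _ bF); apply: isol.
apply: (@leq_trans 1).
  rewrite -(cards1 v); apply: subset_leq_card; apply/subsetP=> v'; rewrite fib => /eqP st'.
  have : e \in star v' by rewrite st' inE.
  by rewrite !inE => /orP[//|/eqP uE]; rewrite -uE st' eqxx in nst.
have leafE x : (forall g : edge G1, x \in val (F g) -> g = e) \/ exists2 g : edge G1, x \in val (F g) & g != e.
  have [/existsP[g /andP[]]|] := boolP [exists g : edge G1, (x \in val (F g)) && (g != e)].
    by right; exists g.
  rewrite negb_exists => /forallP H; left=> g xg; apply/eqP.
  by have := H g; rewrite xg negbK.
apply/card_gt0P.
(* Some end of [F e] lies on no other image. If [F g] passed through [a] and [F h] through [b], then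
   [g] and [h] would both contain [u], so [F h] would contain [a] as well and equal [F e]. *)
have [la|[g ag ge]] := leafE a; first by exists a; rewrite inE starc.
have [lb|[h bh he]] := leafE b; first by exists b; rewrite inE starc.
have eg : e != g by rewrite eq_sym.
have ah : a \in val (F h).
  rewrite (star_transfer h eg ue (at_u _ _ aF ag) aF ag).
  exact: at_u bF bh.
have [_ hE] := edge_eq (valP (F h)) ah bh nab.
case/eqP: he; apply/F_inj/val_inj.
by rewrite hE Fe.
Qed.

End StarFibres.

Lemma nonuniversal_coadj (G : sgraph) (v : G) : ~~ universal v -> exists u, coadj v u.
Proof.
have [/existsP //|] := boolP [exists u, coadj v u].
rewrite negb_exists => /forallP none; case/negP.
rewrite /universal /degree -(cardsC1 v); apply/eqP/eq_card=> u; rewrite !inE.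
have [->|uv] := eqVneq u v; first by rewrite adj_irrefl.
by have := none u; rewrite /coadj eq_sym uv negbK.
Qed.

Lemma star_coadj (G : sgraph) (u v : G) : u != v ->
  coadj u v = (star u :&: star v != set0).
Proof.
move=> uv; apply/idP/set0Pn=> [cuv | [e]].
  by exists (Sub _ (edge2 cuv)); rewrite !inE !eqxx orbT.
by rewrite !inE => /andP[ue ve]; have [] := edge_eq (valP e) ue ve uv.
Qed.

Theorem theorem1p3 (G1 G2 : sgraph) (k1 k2 : nat)
  (nouniv1 : forall v : G1, ~~ universal v)
  (nouniv2 : forall v : G2, ~~ universal v)
  (hk1 : k1 + 2 <= #|G1|) (hk2 : k2 + 2 <= #|G2|)
  (hiso : isomorphic (upper_bell k1 G1) (upper_bell k2 G2)) :
  isomorphic G1 G2.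
Proof.
have hiso' : isomorphic (upper_bell k2 G2) (upper_bell k1 G1).
  case: hiso => phi [psi phiK psiK] phiA; exists psi; first by exists phi.
  by move=> x y; rewrite -phiA !psiK.
have [F [F_inj F_meets F_tri]] := edge_map hk1 hiso.
have [H [H_inj H_meets H_tri]] := edge_map hk2 hiso'.
have F_bij : bijective F by apply: inj_card_bij => //; apply: leq_card H_inj.
have H_bij : bijective H by apply: inj_card_bij => //; apply: leq_card F_inj.
have {}F_tri := F_tri (F_onto F_bij); have {}H_tri := H_tri (F_onto H_bij).
have FM e f : meets (val (F e)) (val (F f)) = meets (val e) (val f).
  apply/idP/idP; last exact: F_meets.
  apply: (@inj_pred_iff _ _ (fun x => (F x.1, F x.2)) (fun y => (H y.1, H y.2))
    (fun x => meets (val x.1) (val x.2)) (fun y => meets (val y.1) (val y.2)) _ _ _ _ (e, f)).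
  - by move=> [? ?] [? ?] [/F_inj-> /F_inj->].
  - by move=> [? ?] [? ?] [/H_inj-> /H_inj->].
  - by move=> x; apply: F_meets.
  - by move=> y; apply: H_meets.
have FT e f g : tri (val (F e)) (val (F f)) (val (F g)) = tri (val e) (val f) (val g).
  apply/idP/idP; last exact: F_tri.
  apply: (@inj_pred_iff _ _ (fun x => (F x.1.1, F x.1.2, F x.2))
    (fun y => (H y.1.1, H y.1.2, H y.2))
    (fun x => tri (val x.1.1) (val x.1.2) (val x.2))
    (fun y => tri (val y.1.1) (val y.1.2) (val y.2)) _ _ _ _ (e, f, g)).
  - by move=> [[? ?] ?] [[? ?] ?] [/F_inj-> /F_inj-> /F_inj->].
  - by move=> [[? ?] ?] [[? ?] ?] [/H_inj-> /H_inj-> /H_inj->].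
  - by move=> x; apply: F_tri.
  - by move=> y; apply: H_tri.
(* Pulling stars back takes a genuine inverse of [F]; [H] is only some bijection in that
   direction. *)
have [F' F'K FK'] := F_bij; have F'_bij : bijective F' by exists F.
have F'_inj := bij_inj F'_bij.
have F'M e f : meets (val (F' e)) (val (F' f)) = meets (val e) (val f).
  by rewrite -FM !FK'.
have F'T e f g : tri (val (F' e)) (val (F' f)) (val (F' g)) = tri (val e) (val f) (val g).
  by rewrite -FT !FK'.
have co1 v : exists u, coadj v u := nonuniversal_coadj (nouniv1 v).
have co2 v : exists u, coadj v u := nonuniversal_coadj (nouniv2 v).
have imF (A : {set edge G2}) : F @: (F' @: A) = A.
  by rewrite -imset_comp -[RHS]imset_id; apply: eq_imset => x /=; rewrite FK'.
(* Vertices are matched when [F] carries the star of one to the star of the other. *)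
have [|f f_bij fE] := @fibre_bij G1 G2 _ (fun v => F @: star v) (@star G2).
  move=> c; apply/eqP; rewrite eqn_leq star_fibre_le //=.
  have := star_fibre_le F'_bij F'M F'T co2 (F' @: c).
  have -> : [set w | F' @: star w == F' @: c] = [set w | star w == c].
    by apply/setP=> w; rewrite !inE (inj_eq (imset_inj F'_inj)).
  have -> // : [set v | star v == F' @: c] = [set v | F @: star v == c].
  by apply/setP=> v; rewrite !inE -{2}(imF c) (inj_eq (imset_inj F_inj)).
exists f => // x y; have [->|xy] := eqVneq x y; first by rewrite !adj_irrefl.
have fxy : f x != f y by rewrite (inj_eq (bij_inj f_bij)).
(* Distinct vertices are adjacent exactly when their stars are disjoint, and [F] preserves
   disjointness. *)
apply: negb_inj; have := star_coadj xy; have := star_coadj fxy.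
rewrite /coadj xy fxy /= !fE -imsetI; last by move=> ? ? _ _; apply: F_inj.
by move=> -> ->; rewrite imset_eq0.
Qed.
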